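(* Let $G\in\{SU(2),SO(3)\}$, $N\in\{1,2,\ldots\}$, $\mathbf{l}\in\mathcal{L}^N$ and $L\in\mathcal{L}_G$. Let $M^{\rm up}$ be the block matrix with column blocks $K'\in\mathcal{M}_L$ (columns $\mathbf{m}'\in\mathcal{M}_{\mathbf{l},K'}$), row blocks $K\in\{-L,-L+1,\ldots,L-1\}\cup\{L+1\}$ (rows $\mathbf{m}\in\mathcal{M}_{\mathbf{l},K}$), and whose only nonzero blocks are, for $K\in\{-L,\ldots,L-1\}$, $$M^{\rm up}_{K,K}[\mathbf{m},\mathbf{m}']=\sqrt{(L+K+1)(L-K)}\,\delta_{\mathbf{m},\mathbf{m}'},$$ $$M^{\rm up}_{K,K+1}[\mathbf{m},\mathbf{m}']=-\sqrt{(l_j+m_j+1)(l_j-m_j)}\ \text{ if }\mathbf{m}'=\mathbf{m}_j^+\text{ for some }j\ (\text{and }0\text{ otherwise}),$$ and $$M^{\rm up}_{L+1,L}[\mathbf{m},\mathbf{m}']=\sqrt{(l_j-m_j+1)(l_j+m_j)}\ \text{ if }\mathbf{m}'=\mathbf{m}_j^-\text{ for some }j\ (\text{and }0\text{ otherwise}).$$ Let $\mathbf{c}_i=\{c_{\mathbf{m},i}\}_{\mathbf{m}\in\mathcal{M}_{\mathbf{l},\le L}}$, $i=1,\ldots,\dim(\ker(M^{\rm up}))$, be a basis of $\ker(M^{\rm up})$. Then a basis of $V^{\mathbf{l},L}$ is given by $$b_i=\Big[\sum_{\mathbf{m}\in\mathcal{M}_{\mathbf{l},K}}c_{\mathbf{m},i}\,\phi^{\mathbf{l}}_{\mathbf{m}}\Big]_{K\in\mathcal{M}_L},\qquad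 i=1,\ldots,\dim(\ker(M^{\rm up})).$$ In addition, $\dim(V^{\mathbf{l},L})=\dim(\ker(M^{\rm up}))=|\mathcal{M}_{\mathbf{l},L}|-|\mathcal{M}_{\mathbf{l},L+1}|$.
   Context: Setting. $\mathcal{L}_{SU(2)}=\{0,\frac12,1,\frac32,\ldots\}$, $\mathcal{L}_{SO(3)}=\{0,1,2,\ldots\}$. For $\ell\in\mathcal{L}_G$, $\mathcal{M}_\ell=\{-\ell,-\ell+1,\ldots,\ell\}$ and $D^\ell:G\to\mathbb{C}^{\mathcal{M}_\ell\times\mathcal{M}_\ell}$ is the Wigner-D matrix (the irreducible representation of dimension $2\ell+1$, in the standard basis for ZYZ Euler angles), characterized by its derivatives at the identity in the directions of the infinitesimal rotations $X_1=X_3$ about $z$ and $X_2$ about $y$ (these generate the Lie algebra): $dD^\ell(X_1)_{\mu,m}=dD^\ell(X_3)_{\mu,m}=-\mathrm{i}m\,\delta_{\mu m}$, and $dD^\ell(X_2)_{\mu,m}=\frac12\sqrt{(\ell-m+1)(\ell+m)}$ if $m=\mu+1$, $-\frac12\sqrt{(\ell+m+1)(\ell-m)}$ if $m=\mu-1$, $0$ otherwise. $\mathcal{L}$ is a totally ordered index set; every $l\in\mathcal{L}$ has a component $\ell\in\mathcal{L}_G$ (e.g. $l=\ell$ or $l=(n,\ell)$), and in arithmetic expressions $l$ stands for its $\ell$-component; $\mathcal{M}_l=\mathcal{M}_\ell$. $G$ acts on a domain $\Omega$ and diagonally on $\Omega^N$. For each $l\in\mathcal{L}$, $\{\phi^l_m\}_{m\in\mathcal{M}_l}$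 are functions $\Omega\to\mathbb{F}$ ($\mathbb{F}$ a complex vector space in which values can be multiplied, e.g. $\mathbb{F}=\mathbb{C}$), orthonormal ($\langle\phi^l_m,\phi^{l'}_{m'}\rangle=\delta_{ll'}\delta_{mm'}$), with $\phi^l_m(Q\cdot r)=\sum_{m'}D^\ell_{m,m'}(Q)\phi^l_{m'}(r)$ for $Q\in G$; $V^l$ is their complex span. For $\mathbf{l}=(l_1,\ldots,l_N)\in\mathcal{L}^N$: $\mathcal{M}_{\mathbf{l}}=\prod_i\mathcal{M}_{l_i}$, $\phi^{\mathbf{l}}_{\mathbf{m}}(r_1,\ldots,r_N)=\prod_i\phi^{l_i}_{m_i}(r_i)$, $V^{\mathbf{l}}=\bigotimes_iV^{l_i}$, with basis $\{\phi^{\mathbf{l}}_{\mathbf{m}}\}$. $V^{\mathbf{l},L}$ is the space of $F\in[V^{\mathbf{l}}]^{2L+1}$ (components indexed by $\mathcal{M}_L$) with $F(Q\cdot R)=D^L(Q)F(R)$ for all $Q\in G$, $R\in\Omega^N$. Notation: $\sum\mathbf{m}=\sum_im_i$; $\mathcal{M}_{\mathbf{l},K}=\{\mathbf{m}\in\mathcal{M}_{\mathbf{l}}:\sum\mathbf{m}=K\}$ (possibly empty); $\mathcal{M}_{\mathbf{l},\le L}=\bigcup_{K\in\mathcal{M}_L}\mathcal{M}_{\mathbf{l},K}$; $\mathbf{m}_j^{\pm}=(m_1,\ldots,m_{j-1},m_j\pm1,m_{j+1},\ldots,m_N)$. Blocks indexed by empty sets are empty. *)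

(* Defs.v *)
From HB Require Import structures.
From mathcomp Require Import all_boot all_order all_algebra.
From mathcomp Require Import complex.
From mathcomp Require Import all_classical all_reals all_analysis.
Set Implicit Arguments.
Unset Strict Implicit.
Unset Printing Implicit Defensive.
Import Order.TTheory GRing.Theory Num.Theory.
Import numFieldNormedType.Exports.
Local Open Scope ring_scope.
Local Open Scope complex_scope.

Inductive rot_group := SU2 | SO3.

Definition ambient (R : realType) (G : rot_group) : nzRingType :=
  match G with
  | SU2 => 'M[R[i]]_2
  | SO3 => 'M[R]_3
  end.

Definition in_group (R : realType) (G : rot_group) : ambient R G -> Prop :=
  match G return ambient R G -> Prop with
  | SU2 => fun Q : 'M[R[i]]_2 => Q \is unitarymx /\ \det Q = 1
  | SO3 => fun Q : 'M[R]_3 => Q *m Q^T = 1%:M /\ \det Q = 1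
  end.

(* The one-parameter subgroup t |-> exp (t X_3) of the rotations about z;
   on SU(2), X_3 = - i sigma_z / 2. *)
Definition rotz (R : realType) (G : rot_group) (t : R) : ambient R G :=
  match G return ambient R G with
  | SU2 => \matrix_(i < 2, j < 2)
      (if i != j then 0
       else if i == ord0 then cos (t / 2) -i* sin (t / 2)
       else cos (t / 2) +i* sin (t / 2))
  | SO3 => \matrix_(i < 3, j < 3)
      nth 0 (nth [::] [:: [:: cos t; - sin t; 0];
                          [:: sin t;   cos t; 0];
                          [:: 0;       0;     1]] i) j
  end.

(* The one-parameter subgroup t |-> exp (t X_2) of the rotations about y;
   on SU(2), X_2 = - i sigma_y / 2. *)
Definition roty (R : realType) (G : rot_group) (t : R) : ambient R G :=
  match G return ambient R G with
  | SU2 => \matrix_(i < 2, j < 2)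
      (nth 0 (nth [::] [:: [:: cos (t / 2); - sin (t / 2)];
                           [:: sin (t / 2);   cos (t / 2)]] i) j)%:C
  | SO3 => \matrix_(i < 3, j < 3)
      nth 0 (nth [::] [:: [:: cos t;   0; sin t];
                          [:: 0;       1; 0    ];
                          [:: - sin t; 0; cos t]] i) j
  end.

(* An element ell of L_G is represented by the natural number 2 ell. *)
Record spin (G : rot_group) := Spin {
  twice : nat;
  _ : if G is SO3 then ~~ odd twice else true
}.

Definition ell (R : realType) (G : rot_group) (l : spin G) : R :=
  (twice l)%:R / 2.

(* M_ell is indexed by 'I_(2 ell + 1); the index k stands for m = k - ell. *)
Notation Mspin l := 'I_(twice l).+1.

Definition mval (R : realType) (G : rot_group) (l : spin G) (k : Mspin l) : R :=
  k%:R - ell R l.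

Definition dDz (R : realType) (G : rot_group) (l : spin G) : 'M[R[i]]_((twice l).+1) :=
  \matrix_(mu < (twice l).+1, m < (twice l).+1)
    (- ('i * (mval R m)%:C) * (mu == m)%:R).

Definition dDy (R : realType) (G : rot_group) (l : spin G) : 'M[R[i]]_((twice l).+1) :=
  \matrix_(mu < (twice l).+1, m < (twice l).+1)
    (let L := ell R l in let x := mval R mu in let y := mval R m in
     if y == x + 1 then 2^-1 * Num.sqrt ((L - y + 1) * (L + y))
     else if y == x - 1 then - (2^-1 * Num.sqrt ((L + y + 1) * (L - y)))
     else 0)%:C.

Definition mx_derive0 (R : realType) (n : nat) (A : R -> 'M[R[i]]_n)
    (A' : 'M[R[i]]_n) : Prop :=
  forall i j : 'I_n,
    is_derive (0 : R) (1 : R) (fun t : R => complex.Re (A t i j)) (complex.Re (A' i j)) /\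
    is_derive (0 : R) (1 : R) (fun t : R => complex.Im (A t i j)) (complex.Im (A' i j)).

(* X_2 and X_3 generate the Lie algebra and the rotations about y and z
   generate G, so at most one D satisfies this on the elements of G. Values of
   D outside G are irrelevant. *)
Definition is_wignerD (R : realType) (G : rot_group)
    (D : forall l : spin G, ambient R G -> 'M[R[i]]_((twice l).+1)) : Prop :=
  forall l : spin G,
    [/\ D l 1 = 1%:M,
        forall P Q, in_group P -> in_group Q -> D l (P * Q) = D l P *m D l Q,
        mx_derive0 (fun t => D l (rotz G t)) (dDz R l) &
        mx_derive0 (fun t => D l (roty G t)) (dDy R l)].

Definition is_action (R : realType) (G : rot_group) (Omega : Type)
    (act : ambient R G -> Omega -> Omega) : Prop :=
  (forall r, act 1 r = r) /\
  (forall P Q, in_group P -> in_group Q ->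
     forall r, act (P * Q) r = act P (act Q r)).

Section LinearAlgebra.
Variables (K : fieldType) (V : lmodType K).

Definition is_subspace (P : V -> Prop) : Prop :=
  P 0 /\ forall (a : K) u v, P u -> P v -> P (a *: u + v).

Definition in_span (I : finType) (v : I -> V) (x : V) : Prop :=
  exists a : I -> K, x = \sum_i a i *: v i.

Definition lin_indep (I : finType) (v : I -> V) : Prop :=
  forall a : I -> K, \sum_i a i *: v i = 0 -> forall i, a i = 0.

(* v is a basis of the subspace P of the possibly infinite-dimensional V. *)
Definition is_basis (I : finType) (P : V -> Prop) (v : I -> V) : Prop :=
  [/\ forall i, P (v i), lin_indep v & forall x, P x -> in_span v x].

Definition has_dim (P : V -> Prop) (d : nat) : Prop :=
  exists v : 'I_d -> V, is_basis P v.

End LinearAlgebra.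

(* An inner product on the subspace H of V. Only semi-definiteness is asked, as
   for the L^2 product of functions that are not identified almost everywhere. *)
Definition is_inner_product (R : realType) (V : lmodType R[i]) (H : V -> Prop)
    (ip : V -> V -> R[i]) : Prop :=
  [/\ is_subspace H,
      forall a u v w, H u -> H v -> H w ->
        ip (a *: u + v) w = a * ip u w + ip v w,
      forall u v, H u -> H v -> ip v u = (ip u v)^* &
      forall u, H u -> 0 <= ip u u].

Section Families.
Variables (R : realType) (G : rot_group) (Omega : Type) (F : algType R[i]).
Variables (I : Type) (comp : I -> spin G).
Variable phi : forall l : I, Mspin (comp l) -> Omega -> F.

Definition Vsingle (l : I) : (Omega -> F) -> Prop := in_span (@phi l).

Variables (N : nat) (l : 'I_N -> I).

Definition Mtuple := {dffun forall i : 'I_N, Mspin (comp (l i))}.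

Definition phi_tuple (m : Mtuple) : ('I_N -> Omega) -> F :=
  fun r => \prod_(i < N) phi (m i) (r i).

Definition Vtuple : (('I_N -> Omega) -> F) -> Prop := in_span phi_tuple.

(* Multiplication of values identifies the abstract tensor product of the
   V^(l_i) with a space of functions on Omega^N, i.e. it does not collapse pure
   tensors. Automatic when F is the field of complex numbers, see
   tensor_faithful_complex. *)
Definition tensor_faithful : Prop :=
  forall (n : 'I_N -> nat) (f : forall i, 'I_(n i) -> Omega -> F),
    (forall i k, Vsingle (l i) (f i k)) -> (forall i, lin_indep (f i)) ->
    lin_indep (fun k : {dffun forall i : 'I_N, 'I_(n i)} =>
      (fun r : 'I_N -> Omega => \prod_(i < N) f i (k i) (r i))).

Variable act : ambient R G -> Omega -> Omega.
Variable D : forall L : spin G, ambient R G -> 'M[R[i]]_((twice L).+1).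
Variable L : spin G.

Definition VL (f : Mspin L -> ('I_N -> Omega) -> F) : Prop :=
  (forall K, Vtuple (f K)) /\
  forall Q, in_group Q -> forall (r : 'I_N -> Omega) (K : Mspin L),
    f K (fun i => act Q (r i)) = \sum_(K' : Mspin L) D L Q K K' *: f K' r.

Definition mtsum (m : Mtuple) : R := \sum_(i < N) mval R (m i).

Definition MK (K : R) : {set Mtuple} := [set m | mtsum m == K].

Definition MleL : {set Mtuple} := \bigcup_(K : Mspin L) MK (mval R K).

Definition Mrows : {set Mtuple} :=
  (\bigcup_(K : Mspin L | mval R K < ell R L) MK (mval R K))
    :|: MK (ell R L + 1).

(* m' = m + e at position j, and m' = m elsewhere *)
Definition shifted (e : R) (m m' : Mtuple) (j : 'I_N) : bool :=
  [forall i, mval R (m' i) == mval R (m i) + (if i == j then e else 0)].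

Definition Mup_entry (m m' : Mtuple) : R :=
  let K := mtsum m in
  let K' := mtsum m' in
  let lj j := ell R (comp (l j)) in
  let mj j := mval R (m j) in
  let Lv := ell R L in
  if K == Lv + 1 then
    if K' == Lv then
      if [pick j | shifted (-1) m m' j] is Some j
      then Num.sqrt ((lj j - mj j + 1) * (lj j + mj j)) else 0
    else 0
  else if K' == K then Num.sqrt ((Lv + K + 1) * (Lv - K)) * (m == m')%:R
  else if K' == K + 1 then
    if [pick j | shifted 1 m m' j] is Some j
    then - Num.sqrt ((lj j + mj j + 1) * (lj j - mj j)) else 0
  else 0.

Definition Mup : 'M[R[i]]_(#|Mrows|, #|MleL|) :=
  \matrix_(i < #|Mrows|, j < #|MleL|) (Mup_entry (enum_val i) (enum_val j))%:C.

Definition kerMup : {vspace 'cV[R[i]]_#|MleL|} := lker (linfun (mulmx Mup)).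

(* c j 0 is the coefficient c_m of m = enum_val j. *)
Definition bfun (c : 'cV[R[i]]_#|MleL|) : Mspin L -> ('I_N -> Omega) -> F :=
  fun K r => \sum_(j < #|MleL| | enum_val j \in MK (mval R K))
               c j 0 *: phi_tuple (enum_val j) r.

End Families.

Lemma dual_points (K : fieldType) (Omega : Type) n (f : 'I_n -> Omega -> K^o) :
  lin_indep f ->
  exists s (x : 'I_s -> Omega) (a : 'I_n -> 'I_s -> K),
    forall k j, \sum_i a k i * f j (x i) = (k == j)%:R.
Proof.
move=> fi.
have step r : (r <= n)%N -> exists s (x : 'I_s -> Omega),
    (r <= \rank (\matrix_(i < s, j < n) (f j (x i) : K)))%N.
  elim: r => [|r IH] ltrn; first by exists 0%N, (fun i : 'I_0 => match notF (ltn_ord i) with end).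
  have [s [x lerA]] := IH (ltnW ltrn).
  set A := \matrix_(i, j) _ in lerA.
  have [//|ltAr] := ltnP r (\rank A); first by exists s, x.
  have rA : (\rank A < n)%N by exact: leq_ltn_trans ltAr ltrn.
  have : kermx A^T != 0 by rewrite kermx_eq0 /row_free mxrank_tr neq_ltn rA.
  case/rowV0Pn => u /sub_kermxP uA u0.
  have [y uy] : exists y, \sum_j u 0 j * f j y != 0.
    apply: contrapT => H; move/eqP: u0; apply; apply/rowP => j; rewrite mxE.
    apply: (fi (fun j => u 0 j)); apply/funext => y; rewrite fct_sumE.
    apply: contrapT => /eqP H'; apply: H; exists y; exact: H'.
  exists s.+1, (fun i => if unlift ord0 i is Some i' then x i' else y).
  set B := \matrix_(i, j) _.
  have AB : (A <= B)%MS.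
    apply/row_subP => i; rewrite (_ : row i A = row (lift ord0 i) B) ?row_sub //.
    by apply/rowP => j; rewrite !mxE liftK.
  have : (A < B)%MS.
    rewrite /ltmx AB /=; apply/negP => /(fun h => submx_trans (row_sub ord0 B) h) /submxP [w Hw].
    have : (u *m (row ord0 B)^T) 0 0 = 0.
      by rewrite Hw trmx_mul mulmxA uA mul0mx mxE.
    move/eqP; apply/negP; rewrite mxE; congr (_ != _): uy.
    by apply: eq_bigr => j _; rewrite !mxE unlift_none.
  by move/rank_ltmx; apply: leq_ltn_trans.
have [s [x rA]] := step n (leqnn n).
set A := \matrix_(i, j) _ in rA.
have fA : row_full A by rewrite /row_full eqn_leq rank_leq_col.
have [C CA] := row_fullP fA.
exists s, x, (fun k i => C k i) => k j.
move/matrixP: CA => /(_ k j); rewrite !mxE => <-.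
by apply: eq_bigr => i _; rewrite mxE.
Qed.

Lemma tensor_faithful_complex (R : realType) (G : rot_group) (Omega I : Type)
    (comp : I -> spin G) (phi : forall l, Mspin (comp l) -> Omega -> R[i]^o) N (l : 'I_N -> I) :
  tensor_faithful (F := R[i]^o) phi l.
Proof.
move=> n f _ fi c Hc k0.
pose P i s := {x : 'I_s -> Omega & {a : 'I_(n i) -> 'I_s -> R[i] |
   forall k j, \sum_t a k t * f i j (x t) = (k == j)%:R}}.
have ex i : {s & P i s}.
  have /cid[s /cid[x /cid[a H]]] := dual_points (fi i).
  by exists s, x, a.
pose J := {i : 'I_N & 'I_(projT1 (ex i))}.
pose x (t : J) := projT1 (projT2 (ex (tag t))) (tagged t).
pose a0 i := projT1 (projT2 (projT2 (ex i))).
pose T i (u : 'I_(projT1 (ex i))) : J := Tagged (fun i => 'I_(projT1 (ex i))) u.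
pose a i k (t : J) := \sum_(u | T i u == t) a0 i k u.
have aP i k j : \sum_t a i k t * f i j (x t) = (k == j)%:R.
  rewrite -(projT2 (projT2 (projT2 (ex i)))) -/(a0 i).
  under eq_bigr => t _ do rewrite mulr_suml.
  rewrite (exchange_big_dep xpredT) //=.
  by apply: eq_bigr => u _; rewrite (big_pred1 (T i u)).
have : \sum_(t : {ffun 'I_N -> J})
   (\prod_i a i (k0 i) (t i)) *
    (\sum_k c k *: (fun r : 'I_N -> Omega => \prod_i f i (k i) (r i))) (fun i => x (t i)) = 0.
  by rewrite Hc; apply: big1 => t _; rewrite mulr0.
have E k : \sum_(t : {ffun 'I_N -> J}) (\prod_i a i (k0 i) (t i)) * (c k * \prod_i f i (k i) (x (t i))) = c k * (k0 == k)%:R.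
  under eq_bigr => t _ do rewrite mulrCA -big_split /=.
  rewrite -mulr_sumr -(bigA_distr_bigA (fun i t => a i (k0 i) t * f i (k i) (x t))).
  congr (_ * _); under eq_bigr => i _ do rewrite aP.
  have [->|] := eqVneq k0 k; first by rewrite big1 // => i _; rewrite eqxx.
  move=> nk; have [i nki] : exists i, k0 i != k i.
    apply/existsP; rewrite -negb_forall; apply: contra nk => /forallP h.
    by apply/eqP/ffunP => i; apply/eqP.
  by rewrite (bigD1 i) //= (negbTE nki) mul0r.
under eq_bigr => t _ do rewrite fct_sumE mulr_sumr.
rewrite exchange_big /= (bigD1 k0) //= E eqxx mulr1 big1 ?addr0 // => k nk.
by rewrite E eq_sym (negbTE nk) mulr0.
Qed.

(* Main.v *)
Require Import Defs.
From HB Require Import structures.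
From mathcomp Require Import all_boot all_order all_algebra.
From mathcomp Require Import complex.
From mathcomp Require Import all_classical all_reals all_analysis.
From mathcomp Require Import ring lra zify.
Import Order.TTheory GRing.Theory Num.Theory.
Import numFieldNormedType.Exports.
Local Open Scope ring_scope.
Local Open Scope complex_scope.
Set Implicit Arguments.
Unset Strict Implicit.
Unset Printing Implicit Defensive.

(** The products [phi_tuple phi m] are linearly independent: each family
    [phi l] is orthonormal and the tensor product is faithful.  Hence a function
    [f] with components in their span is the same as its coefficients [C K m],
    and [f] is equivariant exactly when [C] intertwines the tensor product of
    the representations [D (comp (l i))] with [D L] ([VL_expansion]).

    Both sides of the intertwining relation are one-parameter groups along the
    rotations about [z] and about [y], so along these it holds as soon as it
    holds infinitesimally ([intertwine_one_parameter]: the function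
    [t |-> A (- t) C B t] has zero derivative).  Every rotation is a product of
    such rotations ([euler_angles]), so equivariance amounts to two linear
    equations on [C], one for [X_3] and one for [X_2].

    The [X_3] equation says that [C K m] vanishes unless [m] has weight [K].
    The row [K] of [C] is therefore the part of weight [K] of a single vector
    [c].  The derivative along [X_2] is half the difference of the raising and
    the lowering operator [J+] and [J-], which shift the weight in opposite
    directions, so the [X_2] equation splits into
    [J+ c = lam c] and [J- c = lam c], where [lam] is the scalar by which the
    operators of spin [L] move between neighbouring weights.

    The equations [M^up c = 0] are only part of this system: the lowering
    equations in the weights [-L, ..., L-1] and [J+ c = 0] in weight [L+1].
    The remaining ones follow by the theory of sl_2 ([raising_string],
    [lowering_string]).  The commutator [J+ J- - J- J+] is twice the weight,
    which gives the raising equations by descending induction on the weight.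
    Since [J-] is moreover the adjoint of [J+],
    [|J- v|^2 = |J+ v|^2 + 2 w |v|^2] on vectors of weight [w]
    ([lowering_norm]), so a vector of negative weight that is killed by [J+] is
    zero; applied to [J- c] in weight [-L-1], this ends the string.

    The same identity makes [J-] injective on positive weights.  As [M^up] is
    block triangular, with invertible diagonal blocks in the weights below [L]
    and the transpose of [J-] in the last block, its rows are linearly
    independent ([Mup_row_free]), and the dimension of its kernel is the number
    of columns minus the number of rows. *)

(** * Raising and lowering operators on functions of weight tuples *)

Section Ladder.
Variables (R : realType) (N : nat) (n : 'I_N -> nat).
Local Notation T := {dffun forall i : 'I_N, 'I_(n i).+1}.
Implicit Types (m : T) (v w : T -> R[i]) (j : 'I_N) (k : nat).

(** Setting a component to a natural number, rather than adding or subtracting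
    one, keeps the operators below total: at the two ends of a spin, where the
    new value does not fit, the ladder coefficient is zero. *)
Definition set_at m j k : T := [ffun i => if i == j then inord k else m i].

Lemma set_at_eq m j k : (k <= n j)%N -> set_at m j k j = k :> nat.
Proof. by move=> le_k; rewrite ffunE eqxx inordK. Qed.

Lemma set_at_out m j : (n j <= m j)%N -> set_at m j (m j).+1 j = 0 :> nat.
Proof.
move=> le_m; rewrite ffunE eqxx /inord val_insubd.
by have -> : ((m j).+1 < (n j).+1)%N = false by rewrite ltnS ltnNge le_m.
Qed.

Lemma set_at_neq m j k i : i != j -> set_at m j k i = m i.
Proof. by move=> nij; rewrite ffunE (negbTE nij). Qed.

Lemma set_at_id m j : set_at m j (m j) = m.
Proof.
by apply/ffunP => i; rewrite ffunE; case: eqP => // ->; rewrite inord_val.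
Qed.

Lemma set_at_set m j k k' : set_at (set_at m j k) j k' = set_at m j k'.
Proof. by apply/ffunP => i; rewrite !ffunE; case: eqP. Qed.

Lemma set_atC m j j' k k' :
  j != j' -> set_at (set_at m j k) j' k' = set_at (set_at m j' k') j k.
Proof.
move=> nj; apply/ffunP => i; rewrite !ffunE; case: (eqVneq i j') => // ->.
by rewrite eq_sym (negbTE nj).
Qed.

(** The component [m i] counts from the bottom, so [m i - n i / 2] is its weight. *)
Definition weight m : R := \sum_i ((m i)%:R - (n i)%:R / 2).

Lemma weight_set_at m j k : (k <= n j)%N ->
  weight (set_at m j k) = weight m + (k%:R - (m j)%:R).
Proof.
move=> le_k; rewrite /weight (bigD1 j) //= [in RHS](bigD1 j) //=.
rewrite set_at_eq // (eq_bigr (fun i => (m i)%:R - (n i)%:R / 2)); last first.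
  by move=> i nij; rewrite set_at_neq.
ring.
Qed.

(** The matrix element of the ladder operators of spin [p / 2] between the
    neighbouring basis vectors [k - 1] and [k]; it is the familiar
    sqrt ((l + x) (l - x + 1)) for [l = p / 2] and [x = k - l]. *)
Definition ladder (p k : nat) : R := Num.sqrt (k%:R * (p%:R + 1 - k%:R)).

Lemma ladder0 p : ladder p 0 = 0.
Proof. by rewrite /ladder mul0r sqrtr0. Qed.

Lemma ladder_top p : ladder p p.+1 = 0.
Proof. by rewrite /ladder -natr1 subrr mulr0 sqrtr0. Qed.

Lemma ladder_sqr p k : (k <= p.+1)%N ->
  ladder p k ^+ 2 = k%:R * (p%:R + 1 - k%:R).
Proof.
by move=> le_k; rewrite sqr_sqrtr // mulr_ge0 // subr_ge0 natr1 ler_nat.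
Qed.

(** The operators act on coefficients: the value at [m] collects the
    coefficients of the tuples that are carried to [m], whence the opposite
    shift of the argument. *)
Definition raising v m : R[i] :=
  \sum_j (ladder (n j) (m j))%:C * v (set_at m j (m j).-1).

Definition lowering v m : R[i] :=
  \sum_j (ladder (n j) (m j).+1)%:C * v (set_at m j (m j).+1).

(** The sl_2 commutation relation.  Terms that move two different components
    cancel because the moves commute; moving one component down and up again
    leaves a difference of two squared ladder coefficients, which is twice the
    weight of that component. *)
Lemma raising_lowering v m :
  raising (lowering v) m
  = lowering (raising v) m + (2 * weight m)%:C * v m.
Proof.
pose A j j' := (ladder (n j) (m j))%:C * ((ladder (n j') (set_at m j (m j).-1 j').+1)%:C
  * v (set_at (set_at m j (m j).-1) j' (set_at m j (m j).-1 j').+1)).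
pose B j' j := (ladder (n j') (m j').+1)%:C *
  ((ladder (n j) (set_at m j' (m j').+1 j))%:C
  * v (set_at (set_at m j' (m j').+1) j (set_at m j' (m j').+1 j).-1)).
have AB j j' : A j j' = B j' j +
    (if j' == j then ((2 * ((m j)%:R - (n j)%:R / 2) : R)%:C * v m) else 0).
  case: (eqVneq j' j) => [->{j'}|nj].
    have Aj : A j j = (ladder (n j) (m j) ^+ 2)%:C * v m.
      rewrite /A; have [m0|m_gt0] := posnP (m j).
        by rewrite m0 ladder0 expr0n /= !mul0r.
      have le_m : ((m j).-1 <= n j)%N.
        by rewrite (leq_trans (leq_pred _)) // -ltnS.
      rewrite set_at_eq // prednK // set_at_set set_at_id mulrA.
      by rewrite expr2 rmorphM.
    have Bj : B j j = (ladder (n j) (m j).+1 ^+ 2)%:C * v m.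
      rewrite /B; have := ltn_ord (m j); rewrite ltnS leq_eqVlt.
      case/predU1P => [mn|lt_m].
        by rewrite mn ladder_top expr0n /= !mul0r.
      by rewrite set_at_eq // set_at_set set_at_id mulrA expr2 rmorphM.
    rewrite Aj Bj -mulrDl -rmorphD; congr (_%:C * _).
    rewrite !ladder_sqr //; last exact: ltnW (ltn_ord _).
    by rewrite -natr1; field.
  rewrite addr0 /A /B !set_at_neq //; last by rewrite eq_sym.
  by rewrite set_atC 1?eq_sym // mulrCA.
have -> : raising (lowering v) m = \sum_j \sum_j' A j j'.
  by apply: eq_bigr => j _; rewrite mulr_sumr.
have -> : lowering (raising v) m = \sum_j \sum_j' B j' j.
  by rewrite exchange_big /=; apply: eq_bigr => j _; rewrite mulr_sumr.
rewrite /weight mulr_sumr rmorph_sum mulr_suml -big_split; apply: eq_bigr => j _ /=.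
under eq_bigr do rewrite AB.
by rewrite big_split /= -big_mkcond big_pred1_eq.
Qed.

(** In each component the terms of both sides correspond under
    [m j |-> m j + 1]; the ends of the range contribute nothing since the ladder
    coefficients vanish there. *)
Lemma raising_adjoint v w :
  \sum_m raising v m * w m = \sum_m v m * lowering w m.
Proof.
under eq_bigr do rewrite mulr_suml.
under [RHS]eq_bigr do rewrite mulr_sumr.
rewrite exchange_big [RHS]exchange_big; apply: eq_bigr => j _ /=.
rewrite (bigID (fun m => (0 < m j)%N)) /= [X in _ + X]big1 ?addr0; last first.
  by move=> m; rewrite lt0n negbK => /eqP ->; rewrite ladder0 !mul0r.
rewrite [RHS](bigID (fun m => (m j < n j)%N)) /=.
rewrite [X in _ = _ + X]big1 ?addr0; last first.
  move=> m; rewrite -leqNgt => le_m; have -> : m j = n j :> nat.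
    by apply/eqP; rewrite eqn_leq le_m -ltnS ltn_ord.
  by rewrite ladder_top mul0r mulr0.
rewrite (reindex_onto (fun m => set_at m j (m j).+1)
                      (fun m => set_at m j (m j).-1)) /=; last first.
  move=> m m_gt0; rewrite set_at_eq; last first.
    by rewrite (leq_trans (leq_pred _)) // -ltnS.
  by rewrite set_at_set prednK // set_at_id.
apply: eq_big => m; last first.
  move=> /andP[m_gt0 /eqP mE]; have lt_m : (m j < n j)%N.
    rewrite ltnNge; apply: contraL m_gt0 => le_m.
    by rewrite set_at_out.
  by rewrite mE set_at_eq // -mulrA mulrCA.
have [lt_m|le_m] := ltnP (m j) (n j).
  by rewrite set_at_eq //= set_at_set set_at_id eqxx.
by rewrite set_at_out.
Qed.

(** Only tuples whose weight is one lower contribute with a nonzero coefficient. *)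
Lemma raising_local v w m :
  (forall m', weight m' = weight m - 1 -> v m' = w m') ->
  raising v m = raising w m.
Proof.
move=> vw; apply: eq_bigr => j _; have [m0|m_gt0] := posnP (m j).
  by rewrite m0 ladder0 !mul0r.
have le_m : ((m j).-1 <= n j)%N by rewrite (leq_trans (leq_pred _)) // -ltnS.
by rewrite vw // weight_set_at // -[in X in _ - X](prednK m_gt0) -natr1; ring.
Qed.

Lemma lowering_local v w m :
  (forall m', weight m' = weight m + 1 -> v m' = w m') ->
  lowering v m = lowering w m.
Proof.
move=> vw; apply: eq_bigr => j _; have := ltn_ord (m j).
rewrite ltnS leq_eqVlt => /predU1P[mn|lt_m].
  by rewrite mn ladder_top !mul0r.
by rewrite vw // weight_set_at // -natr1; ring.
Qed.

Lemma raisingZ (a : R[i]) v m : raising (fun m' => a * v m') m = a * raising v m.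
Proof. by rewrite /raising mulr_sumr; apply: eq_bigr => j _; rewrite mulrCA. Qed.

Lemma loweringZ (a : R[i]) v m :
  lowering (fun m' => a * v m') m = a * lowering v m.
Proof. by rewrite /lowering mulr_sumr; apply: eq_bigr => j _; rewrite mulrCA. Qed.

Lemma raising0 m : raising (fun=> 0) m = 0.
Proof. by rewrite /raising big1 // => j _; rewrite mulr0. Qed.

Lemma lowering0 m : lowering (fun=> 0) m = 0.
Proof. by rewrite /lowering big1 // => j _; rewrite mulr0. Qed.

Lemma raising_conj v m : raising (fun m' => ((v m')^*)%R) m = ((raising v m)^*)%R.
Proof.
rewrite /raising rmorph_sum; apply: eq_bigr => j _; rewrite rmorphM; congr (_ * _).
by apply/esym/eqP; rewrite eq_complex /= oppr0 !eqxx.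
Qed.

Lemma lowering_conj v m : lowering (fun m' => ((v m')^*)%R) m = ((lowering v m)^*)%R.
Proof.
rewrite /lowering rmorph_sum; apply: eq_bigr => j _; rewrite rmorphM; congr (_ * _).
by apply/esym/eqP; rewrite eq_complex /= oppr0 !eqxx.
Qed.

(** Adjointness turns the norm of [J- v] into the pairing of [v] with
    [J+ J- v], and the commutator then exchanges the two operators.  This
    positivity replaces the usual argument that a string of weight vectors must
    stop in finite dimension. *)
Lemma lowering_norm v :
  \sum_m `|lowering v m| ^+ 2
  = \sum_m `|raising v m| ^+ 2 + \sum_m (2 * weight m)%:C * `|v m| ^+ 2.
Proof.
under eq_bigr do rewrite normCK -lowering_conj.
rewrite -raising_adjoint -big_split /=.
under eq_bigr do rewrite raising_lowering mulrDl.
rewrite !big_split /=; congr (_ + _); last first.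
  by apply: eq_bigr => m _; rewrite normCK mulrA.
under [RHS]eq_bigr do rewrite normCK -raising_conj mulrC.
rewrite raising_adjoint.
by apply: eq_bigr => m _; rewrite mulrC.
Qed.

Lemma sum_sqr_norm_eq0 (c : T -> R) v :
  (forall m, v m != 0 -> 0 < c m) ->
  \sum_m (c m)%:C * `|v m| ^+ 2 <= 0 -> forall m, v m = 0.
Proof.
move=> c_gt0 le0 m; apply/eqP; case: (eqVneq (v m) 0) => // vm.
have ge0 m' : 0 <= (c m')%:C * `|v m'| ^+ 2.
  have [->|/c_gt0 h] := eqVneq (v m') 0; first by rewrite normr0 expr0n mulr0.
  by rewrite mulr_ge0 ?exprn_ge0 // lecR ltW.
have : \sum_m (c m)%:C * `|v m| ^+ 2 = 0.
  by apply/eqP; rewrite eq_le le0 sumr_ge0.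
move/eqP; rewrite psumr_eq0 // => /allP/(_ m); rewrite mem_index_enum.
move/(_ isT)/eqP/eqP; rewrite mulf_eq0 sqrf_eq0 normr_eq0 (negbTE vm) orbF.
by rewrite (fmorph_eq0 (real_complex R)) gt_eqF // c_gt0.
Qed.

(** By the identity of norms, [2 w |v|^2] summed over the weights [w] would be
    nonnegative. *)
Lemma raising_inj_neg v :
  (forall m, v m != 0 -> weight m < 0) ->
  (forall m, raising v m = 0) -> forall m, v m = 0.
Proof.
move=> neg r0; apply: (@sum_sqr_norm_eq0 (fun m => - (2 * weight m))).
  by move=> m /neg; lra.
have := lowering_norm v; under [X in _ = X + _]eq_bigr do rewrite r0 normr0 expr0n.
rewrite /= big1_eq add0r => E.
under eq_bigr do rewrite rmorphN mulNr.
by rewrite sumrN oppr_le0 -E sumr_ge0 // => m _; rewrite exprn_ge0.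
Qed.

Lemma lowering_inj_pos v :
  (forall m, v m != 0 -> 0 < weight m) ->
  (forall m, lowering v m = 0) -> forall m, v m = 0.
Proof.
move=> pos l0; apply: (@sum_sqr_norm_eq0 (fun m => 2 * weight m)).
  by move=> m /pos; lra.
have := lowering_norm v; under eq_bigr do rewrite l0 normr0 expr0n.
rewrite /= big1_eq => /esym/eqP; rewrite addrC addr_eq0 => /eqP ->.
by rewrite oppr_le0 sumr_ge0 // => m _; rewrite exprn_ge0.
Qed.

End Ladder.

(** * Strings below a highest weight vector *)

Section HighestWeightStrings.
Variables (R : realType) (N : nat) (n : 'I_N -> nat) (nL : nat).
Local Notation T := {dffun forall i : 'I_N, 'I_(n i).+1}.
Local Notation Lr := (nL%:R / 2 : R).
Local Notation weight := (@weight R N n).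

(** The ladder coefficient of spin [L] as a function of the weight.  Defined for
    every real weight, it vanishes at [-L] and at [L + 1], the two moves that leave
    the range [-L, ..., L], so the string equations need no case distinction at
    the ends. *)
Definition weight_ladder (x : R) : R := Num.sqrt ((Lr - x + 1) * (Lr + x)).
Local Notation lam := weight_ladder.

Lemma weight_ladder_sqr x : - Lr <= x -> x <= Lr + 1 ->
  lam x ^+ 2 = (Lr - x + 1) * (Lr + x).
Proof. by move=> x0 x1; rewrite sqr_sqrtr // mulr_ge0 //; lra. Qed.

Lemma weight_ladderE k : lam (k%:R - Lr) = ladder R nL k.
Proof. by congr Num.sqrt; field. Qed.

Lemma weight_ladder_bottom : lam (- Lr) = 0.
Proof. by rewrite /lam subrr mulr0 sqrtr0. Qed.

Lemma weight_ladder_top : lam (Lr + 1) = 0.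
Proof. by rewrite /lam opprD addrA subrr add0r addNr mul0r sqrtr0. Qed.

Lemma weight_ladder_neq0 x : - Lr < x -> x <= Lr -> lam x != 0.
Proof. by move=> x0 x1; rewrite gt_eqF // sqrtr_gt0 mulr_gt0 //; lra. Qed.

(** The kernel of [M^up] in terms of operators: a vector with weights in
    [-L, ..., L] whose part of weight [L] is killed by raising, and whose lower
    parts are obtained from it by successive lowering. *)
Definition highest_weight_string (c : T -> R[i]) : Prop :=
  [/\ forall m, c m != 0 -> exists2 k, (k <= nL)%N & weight m = k%:R - Lr,
      forall m k, (k < nL)%N -> weight m = k%:R - Lr ->
        lowering c m = (lam (weight m + 1))%:C * c m
    & forall m, weight m = Lr + 1 -> raising c m = 0].

Section String.
Variable c : T -> R[i].
Hypothesis c_string : highest_weight_string c.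

Let supp m : c m != 0 -> exists2 k, (k <= nL)%N & weight m = k%:R - Lr.
Proof. by case: c_string => supp _ _; apply: supp. Qed.

Let lowered m k : (k < nL)%N -> weight m = k%:R - Lr ->
  lowering c m = (lam (weight m + 1))%:C * c m.
Proof. by case: c_string => _ lowered _; apply: lowered. Qed.

Let top m : weight m = Lr + 1 -> raising c m = 0.
Proof. by case: c_string => _ _ top; apply: top. Qed.

(** Descending induction on the weight, as in the classification of the
    representations of sl_2: the part of weight [x - 1] is a multiple of the
    lowering of the part of weight [x], and the commutator moves the raising
    operator past the lowering one. *)
Lemma raising_inside_string j m : (j <= nL)%N -> weight m = Lr + 1 - j%:R ->
  raising c m = (lam (weight m))%:C * c m.
Proof.
elim: j m => [|j IH] m.
  by move=> _; rewrite subr0 => wm; rewrite wm weight_ladder_top mul0r top.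
move=> lt_j wm; have wmE : weight m = (nL - j)%:R - Lr.
  rewrite wm natrB; last exact: ltnW.
  by rewrite -natr1; field.
have jL : j.+1%:R <= nL%:R :> R by rewrite ler_nat.
have j0 : 0 <= j%:R :> R by rewrite ler0n.
move: jL wm; rewrite -natr1 => jL wm.
have m_lo : - Lr < weight m by rewrite wm; lra.
have m_hi : weight m <= Lr by rewrite wm; lra.
have lam_neq0 : (lam (weight m))%:C != 0.
  by rewrite (fmorph_eq0 (real_complex R)) weight_ladder_neq0.
apply: (mulfI lam_neq0).
rewrite -raisingZ (@raising_local _ _ _ _ (lowering c)); last first.
  move=> m' wm'; rewrite (@lowered m' (nL - j.+1)); first 1 last.
  - by rewrite ltn_subrL /=; apply: leq_ltn_trans lt_j.
  - by rewrite wm' wm natrB // -natr1; field.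
  by rewrite wm' subrK.
rewrite raising_lowering (@lowering_local _ _ _ _
  (fun m' => (lam (weight m + 1))%:C * c m')); last first.
  by move=> m' wm'; rewrite (IH m') ?wm' ?(ltnW lt_j) // wm; ring.
have lowm : (lam (weight m + 1))%:C * lowering c m
            = (lam (weight m + 1) ^+ 2)%:C * c m.
  have [j_eq0|j_gt0] := posnP j.
    have -> : weight m + 1 = Lr + 1 by rewrite wm j_eq0; ring.
    by rewrite weight_ladder_top expr0n /= !mul0r.
  rewrite (lowered _ wmE); first by rewrite mulrA -rmorphM.
  by rewrite ltn_subrL j_gt0; apply: leq_ltn_trans lt_j.
rewrite loweringZ lowm mulrA -mulrDl -rmorphD -rmorphM -expr2.
have -> : lam (weight m + 1) ^+ 2
    = (Lr - (weight m + 1) + 1) * (Lr + (weight m + 1)).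
  by apply: weight_ladder_sqr; lra.
have -> : lam (weight m) ^+ 2 = (Lr - weight m + 1) * (Lr + weight m).
  by apply: weight_ladder_sqr; lra.
by congr (_%:C * _); ring.
Qed.

(** Lowering the lowest part of the string produces a vector of weight [-L-1];
    raising kills it by the commutation relation, and no nonzero vector of
    negative weight is killed by raising. *)
Lemma lowering_bottom m : weight m = - Lr - 1 -> lowering c m = 0.
Proof.
(* Cutting off the other weights leaves a vector of negative weights only. *)
move=> wm; pose w m := if weight m == - Lr - 1 then lowering c m else 0.
suff /(_ m) : forall m, w m = 0 by rewrite /w wm eqxx.
apply: raising_inj_neg => {wm}m.
  rewrite /w; case: (weight m =P _) => [-> _|_]; last by rewrite eqxx.
  by have := ler0n R nL; lra.
have [wm|nwm] := eqVneq (weight m) (- Lr); last first.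
  rewrite (@raising_local _ _ _ _ (fun=> 0)) ?raising0 // => m' wm'.
  rewrite /w; case: eqP => // wm''; case/eqP: nwm; lra.
rewrite (@raising_local _ _ _ _ (lowering c)); last first.
  by move=> m' wm'; rewrite /w wm' wm eqxx.
rewrite raising_lowering (@lowering_local _ _ _ _
  (fun m' => (lam (weight m + 1))%:C * c m')); last first.
  (* For L = 0 the weight -L + 1 is L + 1, above the string. *)
  have [nL0|nL_gt0] := posnP nL.
    move=> m' wm'; rewrite top; last by rewrite wm' wm nL0; ring.
    have -> : weight m + 1 = Lr + 1 by rewrite wm nL0; ring.
    by rewrite weight_ladder_top mul0r.
  by move=> m' wm'; rewrite (@raising_inside_string nL) ?wm' // wm; field.
rewrite loweringZ.
have -> : (lam (weight m + 1))%:C * lowering c m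
            = (lam (weight m + 1) ^+ 2)%:C * c m.
  have [nL0|nL_gt0] := posnP nL.
    have -> : weight m + 1 = Lr + 1 by rewrite wm nL0; ring.
    by rewrite weight_ladder_top expr0n /= !mul0r.
  by rewrite (@lowered m 0%N) ?sub0r // mulrA -rmorphM.
rewrite -mulrDl -rmorphD weight_ladder_sqr wm; last by have := ler0n R nL; lra.
  by rewrite (_ : _ + _ = 0) ?mul0r //; field.
by have := ler0n R nL; lra.
Qed.

Lemma raising_string m : raising c m = (lam (weight m))%:C * c m.
Proof.
case: (pselect (exists2 k, (k <= nL)%N & weight m = k%:R - Lr + 1)).
  case=> k le_k wm; have [k_eq|k_lt] : k = nL \/ (k < nL)%N by lia.
    have wm' : weight m = Lr + 1 by rewrite wm k_eq; field.
    by rewrite top // wm' weight_ladder_top mul0r.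
  apply: (@raising_inside_string (nL - k)); first by lia.
  by rewrite wm natrB //; field.
move=> nk; rewrite (@raising_local _ _ _ _ (fun=> 0)) ?raising0; last first.
  move=> m' wm'; apply: contra_notP nk => /eqP /supp[k le_k wk].
  by exists k => //; rewrite -wk wm' subrK.
have [->|/supp[[|k] le_k wm]] := eqVneq (c m) 0; first by rewrite mulr0.
  by rewrite wm sub0r weight_ladder_bottom mul0r.
by case: nk; exists k; rewrite ?(ltnW le_k) // wm -natr1; ring.
Qed.

Lemma lowering_string m : lowering c m = (lam (weight m + 1))%:C * c m.
Proof.
case: (pselect (exists2 k, (k <= nL)%N & weight m = k%:R - Lr - 1)).
  case=> -[|k] le_k wm.
    have wm' : weight m = - Lr - 1 by rewrite wm sub0r.
    by rewrite lowering_bottom // wm' subrK weight_ladder_bottom mul0r.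
  by rewrite (@lowered m k) // wm -natr1; ring.
move=> nk; rewrite (@lowering_local _ _ _ _ (fun=> 0)) ?lowering0; last first.
  move=> m' wm'; apply: contra_notP nk => /eqP /supp[k le_k wk].
  by exists k => //; rewrite -wk wm' addrK.
have [->|/supp[k le_k wm]] := eqVneq (c m) 0; first by rewrite mulr0.
have [k_eq|k_lt] : k = nL \/ (k < nL)%N by lia.
  have -> : weight m + 1 = Lr + 1 by rewrite wm k_eq; field.
  by rewrite weight_ladder_top mul0r.
by case: nk; exists k.+1; rewrite // wm -natr1; ring.
Qed.

End String.
End HighestWeightStrings.

(** * One-parameter groups of matrices *)

Section ComplexDerivative.
Variable R : realType.
Implicit Types (f g : R -> R[i]) (x : R) (a b : R[i]).

(** Real and imaginary parts are differentiated separately, as in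
    [mx_derive0], but at an arbitrary point. *)
Definition is_cderive x f a :=
  is_derive x (1 : R) (fun t => complex.Re (f t)) (complex.Re a) /\
  is_derive x (1 : R) (fun t => complex.Im (f t)) (complex.Im a).

Lemma is_cderive_unique x f a b : is_cderive x f a -> is_cderive x f b -> a = b.
Proof.
case=> fa1 fa2 [fb1 fb2]; apply/eqP; rewrite eq_complex.
by rewrite -(@derive_val _ _ _ _ _ _ _ fa1) (@derive_val _ _ _ _ _ _ _ fb1)
  -(@derive_val _ _ _ _ _ _ _ fa2) (@derive_val _ _ _ _ _ _ _ fb2) !eqxx.
Qed.

Lemma is_cderive_cst x a : is_cderive x (fun=> a) 0.
Proof. by split; apply: is_derive_cst. Qed.

Lemma is_cderiveD x f g a b : is_cderive x f a -> is_cderive x g b ->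
  is_cderive x (fun t => f t + g t) (a + b).
Proof.
case=> fa1 fa2 [gb1 gb2]; split.
  rewrite (_ : (fun t => _) = (fun t => complex.Re (f t))
    + (fun t => complex.Re (g t))); last first.
    by apply/funext => t; rewrite raddfD.
  by rewrite raddfD; apply: is_deriveD.
rewrite (_ : (fun t => _) = (fun t => complex.Im (f t))
    + (fun t => complex.Im (g t))); last first.
  by apply/funext => t; rewrite raddfD.
by rewrite raddfD; apply: is_deriveD.
Qed.

Lemma ReD a b : complex.Re (a + b) = complex.Re a + complex.Re b.
Proof. by case: a b => [? ?] []. Qed.

Lemma ImD a b : complex.Im (a + b) = complex.Im a + complex.Im b.
Proof. by case: a b => [? ?] []. Qed.

Lemma ReM a b : complex.Re (a * b)
  = complex.Re a * complex.Re b - complex.Im a * complex.Im b.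
Proof. by case: a b => [? ?] []. Qed.

Lemma ImM a b : complex.Im (a * b)
  = complex.Re a * complex.Im b + complex.Im a * complex.Re b.
Proof. by case: a b => [? ?] []. Qed.

Lemma is_cderiveM x f g a b : is_cderive x f a -> is_cderive x g b ->
  is_cderive x (fun t => f t * g t) (a * g x + f x * b).
Proof.
case=> fa1 fa2 [gb1 gb2]; split.
  rewrite (_ : (fun t => _) =
     (fun t => complex.Re (f t)) * (fun t => complex.Re (g t))
     - (fun t => complex.Im (f t)) * (fun t => complex.Im (g t))); last first.
    by apply/funext => t; rewrite ReM.
  apply: is_derive_eq; rewrite ReD !ReM /GRing.scale /=; ring.
rewrite (_ : (fun t => _) =
   (fun t => complex.Re (f t)) * (fun t => complex.Im (g t))
   + (fun t => complex.Im (f t)) * (fun t => complex.Re (g t))); last first.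
  by apply/funext => t; rewrite ImM.
apply: is_derive_eq; rewrite ImD !ImM /GRing.scale /=; ring.
Qed.

Lemma is_cderive_sum x (I : Type) (r : seq I) (f : I -> R -> R[i]) (a : I -> R[i]) :
  (forall i, is_cderive x (f i) (a i)) ->
  is_cderive x (fun t => \sum_(i <- r) f i t) (\sum_(i <- r) a i).
Proof.
move=> fa; elim: r => [|i r IH].
  rewrite big_nil (_ : (fun=> _) = (fun=> 0)); first exact: is_cderive_cst.
  by apply/funext => t; rewrite big_nil.
rewrite big_cons (_ : (fun=> _) = (fun t => f i t + \sum_(j <- r) f j t)).
  exact: is_cderiveD.
by apply/funext => t; rewrite big_cons.
Qed.

Lemma is_cderive_prod x (I : finType) (f : I -> R -> R[i]) (a : I -> R[i]) :
  (forall i, is_cderive x (f i) (a i)) ->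
  is_cderive x (fun t => \prod_i f i t)
    (\sum_j a j * \prod_(i | i != j) f i x).
Proof.
move=> fa.
suff H (r : seq I) : uniq r -> is_cderive x (fun t => \prod_(i <- r) f i t)
    (\sum_(j <- r) a j * \prod_(i <- r | i != j) f i x).
  have := H _ (index_enum_uniq I); exact.
elim: r => [|i r IH] /=.
  rewrite big_nil (_ : (fun=> _) = (fun=> 1)); first by move=> _; exact: is_cderive_cst.
  by apply/funext => t; rewrite big_nil.
case/andP=> ir ur.
rewrite (_ : (fun=> _) = (fun t => f i t * \prod_(j <- r) f j t)); last first.
  by apply/funext => t; rewrite big_cons.
have := is_cderiveM (fa i) (IH ur); congr is_cderive.
rewrite big_cons big_cons eqxx /=; congr (_ * _ + _).
  rewrite big_seq [RHS]big_seq_cond; apply: eq_bigl => j; rewrite andbC.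
  by case: (eqVneq j i) => //= ->; rewrite (negbTE ir).
rewrite mulr_sumr big_seq [RHS]big_seq; apply: eq_bigr => j jr.
rewrite big_cons mulrCA; case: (eqVneq i j) => // ij.
by rewrite ij jr in ir.
Qed.

Lemma is_cderive_comp x f (g : R -> R) a (b : R) :
  is_cderive (g x) f a -> is_derive x (1 : R) g b ->
  is_cderive x (fun t => f (g t)) (a * b%:C).
Proof.
case=> fa1 fa2 gb; split.
  apply: is_derive_eq.
    exact: (@is_derive1_comp _ (fun t => complex.Re (f t)) g).
  by rewrite ReM /= mulr0 subr0.
apply: is_derive_eq.
  exact: (@is_derive1_comp _ (fun t => complex.Im (f t)) g).
by rewrite ImM /= mulr0 add0r.
Qed.

Lemma is_cderive0_cst f : (forall x, is_cderive x f 0) -> forall x y, f x = f y.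
Proof.
move=> f0 x y; apply/eqP; rewrite eq_complex; apply/andP; split; apply/eqP.
  by apply: (@is_derive_0_is_cst _ (fun t => complex.Re (f t))) => z; case: (f0 z).
by apply: (@is_derive_0_is_cst _ (fun t => complex.Im (f t))) => z; case: (f0 z).
Qed.

End ComplexDerivative.

Section OneParameter.
Variables (R : realType).

Definition mx_cderive p q x (A : R -> 'M[R[i]]_(p, q)) (A' : 'M[R[i]]_(p, q)) :=
  forall i j, is_cderive x (fun t => A t i j) (A' i j).

Lemma mx_cderiveM p q r x (A : R -> 'M[R[i]]_(p, q)) (B : R -> 'M[R[i]]_(q, r))
    A' B' : mx_cderive x A A' -> mx_cderive x B B' ->
  mx_cderive x (fun t => A t *m B t) (A' *m B x + A x *m B').
Proof.
move=> dA dB i j.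
rewrite (_ : (fun=> _) = (fun t => \sum_k A t i k * B t k j)); last first.
  by apply/funext => t; rewrite mxE.
rewrite !mxE -big_split /=; apply: is_cderive_sum => k.
exact: is_cderiveM (dA i k) (dB k j).
Qed.

Lemma mx_cderive_cst p q x (A : 'M[R[i]]_(p, q)) : mx_cderive x (fun=> A) 0.
Proof. by move=> i j; rewrite mxE; apply: is_cderive_cst. Qed.

(** If the relation holds at the level of derivatives, then
    [P t = A (- t) C B t] has derivative zero at 0, hence everywhere because
    [P t = A (- s) P (t - s) B s]; so [P] is constantly [C]. *)
Lemma intertwine_one_parameter p q (A : R -> 'M[R[i]]_p) (B : R -> 'M[R[i]]_q)
    A' B' (C : 'M[R[i]]_(p, q)) :
  A 0 = 1%:M -> B 0 = 1%:M ->
  (forall s t, A (s + t) = A s *m A t) -> (forall s t, B (s + t) = B s *m B t) ->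
  mx_cderive 0 A A' -> mx_cderive 0 B B' ->
  (forall t, C *m B t = A t *m C) <-> C *m B' = A' *m C.
Proof.
move=> A0 B0 AD BD dA dB; split=> [CE|CE t].
  have dL : mx_cderive 0 (fun t => C *m B t) (C *m B').
    by have := mx_cderiveM (mx_cderive_cst 0 C) dB; rewrite mul0mx add0r.
  have dR : mx_cderive 0 (fun t => A t *m C) (A' *m C).
    by have := mx_cderiveM dA (mx_cderive_cst 0 C); rewrite mulmx0 addr0.
  apply/matrixP => i j; apply: is_cderive_unique (dL i j) _.
  by rewrite (_ : (fun=> _) = (fun t => (A t *m C) i j)) //; apply/funext => t; rewrite CE.
pose P t := A (- t) *m C *m B t.
have dP0 : mx_cderive 0 P 0.
  have dN : mx_cderive 0 (fun t => A (- t)) (- A').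
    move=> i j; rewrite mxE -mulrN1 (_ : -1 = (-1 : R)%:C); last by rewrite rmorphN1.
    apply: (@is_cderive_comp _ _ (fun t => A t i j) -%R).
    by rewrite oppr0.
  have := mx_cderiveM (mx_cderiveM dN (mx_cderive_cst 0 C)) dB.
  by rewrite oppr0 A0 B0 mulmx0 addr0 mulmx1 mul1mx CE mulNmx addNr.
have dP s : mx_cderive s P 0.
  move=> i j.
  have -> : (fun u => P u i j) = (fun u => (A (- s) *m P (u - s) *m B s) i j).
    apply/funext => u; rewrite /P -!mulmxA -BD [in RHS]mulmxA -AD.
    by congr ((A _ *m (_ *m B _)) _ _); ring.
  have d0 : mx_cderive 0 (fun t => A (- s) *m P t *m B s) 0.
    have := mx_cderiveM (mx_cderiveM (mx_cderive_cst 0 (A (- s))) dP0)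
      (mx_cderive_cst 0 (B s)).
    by rewrite mul0mx mulmx0 addr0 mul0mx mulmx0 addr0.
  have := @is_cderive_comp _ s (fun t => (A (- s) *m P t *m B s) i j)
    (fun t => t - s) (0 : R[i]) 1; rewrite mul0r mxE; apply.
    by rewrite subrr; have := d0 i j; rewrite mxE.
  apply: is_derive_eq; last by rewrite subr0.
have PE : P t = C.
  apply/matrixP => i j.
  rewrite (@is_cderive0_cst _ (fun t => P t i j) _ t 0).
    by rewrite /P oppr0 A0 B0 mul1mx mulmx1.
  by move=> s; have := dP s i j; rewrite mxE.
by rewrite -{2}PE /P !mulmxA -AD subrr A0 mul1mx.
Qed.

End OneParameter.

(** * Euler angles *)

Section Angles.
Variable R : realType.

Lemma polar_angle (x y : R) : x ^+ 2 + y ^+ 2 = 1 ->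
  exists t, cos t = x /\ sin t = y.
Proof.
move=> xy; have x1 : -1 <= x <= 1.
  by rewrite -ler_norml -(@expr_le1 _ 2) // ?real_normK ?num_real // -xy lerDl sqr_ge0.
have sE : sin (acos x) = `|y|.
  by rewrite sin_acos // -xy addrC addKr sqrtr_sqr.
have [y0|y0] := leP 0 y.
  by exists (acos x); rewrite acosK ?in_itv // sE ger0_norm.
by exists (- acos x); rewrite cosN acosK ?in_itv // sinN sE ltr0_norm // opprK.
Qed.

Lemma polar_coords (x y : R) :
  exists r t, [/\ 0 <= r, r ^+ 2 = x ^+ 2 + y ^+ 2, x = r * cos t & y = r * sin t].
Proof.
have ge0 : 0 <= x ^+ 2 + y ^+ 2 by rewrite addr_ge0 ?sqr_ge0.
pose r := Num.sqrt (x ^+ 2 + y ^+ 2).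
have rE : r ^+ 2 = x ^+ 2 + y ^+ 2 by rewrite sqr_sqrtr.
have [r0|r_neq0] := eqVneq r 0.
  exists 0, 0; rewrite expr0n /= !mul0r lexx -rE r0 expr0n; split=> //.
    by apply/eqP; rewrite -sqrf_eq0; apply/eqP; move: rE; rewrite r0 expr0n /=; nra.
  by apply/eqP; rewrite -sqrf_eq0; apply/eqP; move: rE; rewrite r0 expr0n /=; nra.
have [|t [ct st]] := @polar_angle (x / r) (y / r).
  by rewrite !expr_div_n -mulrDl -rE divff // sqrf_eq0.
exists r, t; split=> //; first exact: sqrtr_ge0.
  by rewrite ct mulrC divfK.
by rewrite st mulrC divfK.
Qed.

Lemma ord2P (P : 'I_2 -> Prop) : P 0 -> P 1 -> forall i, P i.
Proof.
move=> P0 P1 [[|[|//]] h].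
  by rewrite (_ : Ordinal h = 0) //; apply: val_inj.
by rewrite (_ : Ordinal h = 1) //; apply: val_inj.
Qed.

Lemma ord3P (P : 'I_3 -> Prop) : P 0 -> P 1 -> P 2%R -> forall i, P i.
Proof.
move=> P0 P1 P2 [[|[|[|//]]] h].
- by rewrite (_ : Ordinal h = 0) //; apply: val_inj.
- by rewrite (_ : Ordinal h = 1) //; apply: val_inj.
- by rewrite (_ : Ordinal h = 2%R) //; apply: val_inj.
Qed.

Lemma rotz0 G : rotz G (0 : R) = 1.
Proof.
case: G => /=; apply/matrixP.
  by apply: ord2P; apply: ord2P; rewrite !mxE /= ?mul0r ?cos0 ?sin0 ?oppr0.
by apply: ord3P; apply: ord3P; rewrite !mxE /= ?cos0 ?sin0 ?oppr0.
Qed.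

Lemma roty0 G : roty G (0 : R) = 1.
Proof.
case: G => /=; apply/matrixP.
  by apply: ord2P; apply: ord2P; rewrite !mxE /= ?mul0r ?cos0 ?sin0 ?oppr0.
by apply: ord3P; apply: ord3P; rewrite !mxE /= ?cos0 ?sin0 ?oppr0.
Qed.

Lemma rotzD G (s t : R) : rotz G (s + t) = rotz G s * rotz G t.
Proof.
case: G => /=; apply/matrixP.
{ apply: ord2P; apply: ord2P; rewrite !mxE !big_ord_recr big_ord0 /= !mxE /=.
  all: rewrite ?(mulr0, mul0r, add0r, addr0) // mulrDl ?cosD ?sinD.
  all: by apply/eqP; rewrite eq_complex /=; apply/andP; split; apply/eqP; ring. }
{ apply: ord3P; apply: ord3P; rewrite !mxE !big_ord_recr big_ord0 /= !mxE /=.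
  all: by rewrite ?cosD ?sinD; ring. }
Qed.

Lemma rotyD G (s t : R) : roty G (s + t) = roty G s * roty G t.
Proof.
case: G => /=; apply/matrixP.
{ apply: ord2P; apply: ord2P; rewrite !mxE !big_ord_recr big_ord0 /= !mxE /=.
  all: rewrite mulrDl ?cosD ?sinD.
  all: by apply/eqP; rewrite eq_complex /=; apply/andP; split; apply/eqP; ring. }
{ apply: ord3P; apply: ord3P; rewrite !mxE !big_ord_recr big_ord0 /= !mxE /=.
  all: by rewrite ?cosD ?sinD; ring. }
Qed.
End Angles.

Section Det.
Variable S : comUnitRingType.

(** Indexing the entries by natural numbers lets the lifted indices of minors
    reduce by computation. *)
Lemma matrix_nat_entries n (A : 'M[S]_n.+1) :
  exists a : nat -> nat -> S, A = \matrix_(i, j) a i j.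
Proof.
exists (fun i j => A (inord i) (inord j)).
by apply/matrixP => i j; rewrite mxE !inord_val.
Qed.

Lemma det_mx22 (A : 'M[S]_2) : \det A = A 0 0 * A 1 1 - A 0 1 * A 1 0.
Proof.
have [a ->] := matrix_nat_entries A.
rewrite (expand_det_row _ 0) !big_ord_recl big_ord0 /cofactor !det_mx11 !mxE /=.
rewrite /bump /=; ring.
Qed.

Lemma det_mx33 (A : 'M[S]_3) : \det A =
  A 0 0 * (A 1 1 * A 2%R 2%R - A 1 2%R * A 2%R 1)
  - A 0 1 * (A 1 0 * A 2%R 2%R - A 1 2%R * A 2%R 0)
  + A 0 2%R * (A 1 0 * A 2%R 1 - A 1 1 * A 2%R 0).
Proof.
have [a ->] := matrix_nat_entries A.
rewrite (expand_det_row _ 0) !big_ord_recl big_ord0 /cofactor !det_mx22 !mxE /=.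
rewrite /bump /=; ring.
Qed.

Lemma adj_mx22 (A : 'M[S]_2) :
  [/\ \adj A 0 0 = A 1 1, \adj A 0 1 = - A 0 1,
      \adj A 1 0 = - A 1 0 & \adj A 1 1 = A 0 0].
Proof.
have [a ->] := matrix_nat_entries A.
by split; rewrite !mxE /cofactor det_mx11 !mxE /bump /=; ring.
Qed.

(** The minors that determine a rotation which fixes the third axis. *)
Lemma adj_mx33_entries (A : 'M[S]_3) :
  [/\ \adj A 0 0 = A 1 1 * A 2%R 2%R - A 1 2%R * A 2%R 1,
      \adj A 1 0 = A 1 2%R * A 2%R 0 - A 1 0 * A 2%R 2%R,
      \adj A 0 2%R = A 0 1 * A 1 2%R - A 0 2%R * A 1 1
    & \adj A 1 2%R = A 0 2%R * A 1 0 - A 0 0 * A 1 2%R].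
Proof.
have [a ->] := matrix_nat_entries A.
by split; rewrite !mxE /cofactor det_mx22 !mxE /bump /=; ring.
Qed.

(** For a matrix of determinant one this expresses the entries of the inverse,
    here the transpose or the adjoint, as minors; it spares solving the
    quadratic orthogonality relations. *)
Lemma right_inverse_adj n (A B : 'M[S]_n) :
  A *m B = 1%:M -> \det A = 1 -> B = \adj A.
Proof.
by move=> /mulmx1C BA dA; rewrite -[RHS]mul1mx -BA -mulmxA mul_mx_adj dA mulmx1.
Qed.
End Det.

Section GroupElements.
Variable R : realType.

Lemma in_groupM G (P Q : ambient R G) :
  in_group P -> in_group Q -> in_group (P * Q).
Proof.
case: G P Q => /= P Q [uP dP] [uQ dQ]; split.
- exact: mul_unitarymx.
- by rewrite det_mulmx dP dQ mulr1.
- by rewrite trmx_mul mulmxA -[_ *m Q *m _]mulmxA uQ mulmx1.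
- by rewrite det_mulmx dP dQ mulr1.
Qed.

(** The transpose, respectively the adjoint, of a rotation is the rotation by the
    opposite angle, which is its inverse by additivity in the angle. *)
Lemma in_group_rotz G (t : R) : in_group (rotz G t).
Proof.
have zN : rotz G t * rotz G (- t) = 1 by rewrite -rotzD subrr rotz0.
case: G zN => /= zN; split.
{ apply/unitarymxP; rewrite -[RHS]zN; congr (_ *m _).
  apply/matrixP; apply: ord2P; apply: ord2P; rewrite !mxE /= ?mulNr ?cosN ?sinN.
  all: by apply/eqP; rewrite eq_complex /= ?oppr0 ?opprK !eqxx. }
- rewrite det_mx22 !mxE /= mul0r subr0; apply/eqP; rewrite eq_complex /=.
  rewrite mulNr opprK -!expr2 cos2Dsin2 eqxx /=; apply/eqP; ring.
- rewrite -[RHS]zN; congr (_ *m _).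
  by apply/matrixP; apply: ord3P; apply: ord3P; rewrite !mxE /= ?cosN ?sinN ?opprK.
- rewrite det_mx33 !mxE /= -[RHS](cos2Dsin2 t); ring.
Qed.

Lemma in_group_roty G (t : R) : in_group (roty G t).
Proof.
have yN : roty G t * roty G (- t) = 1 by rewrite -rotyD subrr roty0.
case: G yN => /= yN; split.
{ apply/unitarymxP; rewrite -[RHS]yN; congr (_ *m _).
  apply/matrixP; apply: ord2P; apply: ord2P; rewrite !mxE /= mulNr ?cosN ?sinN.
  all: by apply/eqP; rewrite eq_complex /= ?oppr0 ?opprK !eqxx. }
- rewrite det_mx22 !mxE /= -!rmorphM -rmorphB.
  by rewrite mulNr opprK -!expr2 cos2Dsin2.
- rewrite -[RHS]yN; congr (_ *m _).
  by apply/matrixP; apply: ord3P; apply: ord3P; rewrite !mxE /= ?cosN ?sinN ?opprK.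
- rewrite det_mx33 !mxE /= -[RHS](cos2Dsin2 t); ring.
Qed.

End GroupElements.

Section EulerAngles.
Variable R : realType.

(** An element of SU(2) is determined by its first column [(a, c)], with
    [|a|^2 + |c|^2 = 1].  The moduli of [a] and [c] are the cosine and the sine of
    half the middle angle, and their arguments are the half sum and the half
    difference of the outer angles, up to sign. *)
Lemma SU2_euler (Q : 'M[R[i]]_2) : @in_group R SU2 Q ->
  exists a b c, Q = rotz SU2 a * (roty SU2 b * rotz SU2 c).
Proof.
case=> /unitarymxP uQ dQ; have adjE := right_inverse_adj uQ dQ.
have [a00 a01 _ _] := adj_mx22 Q.
have d_E : Q 1 1 = conjc (Q 0 0) by rewrite -a00 -adjE !mxE.
have b_E : Q 0 1 = - conjc (Q 1 0) by rewrite -[LHS]opprK -a01 -adjE !mxE.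
move: dQ; rewrite det_mx22 d_E b_E.
case a_E : (Q 0 0) => [x y]; case c_E : (Q 1 0) => [u v] /eqP.
rewrite eq_complex /= => /andP[/eqP dQ _].
have [r [p [r0 rE xE yE]]] := polar_coords x y.
have [s [q [s0 sE uE vE]]] := polar_coords u v.
have [|h [hc hs]] := @polar_angle _ r s.
  by rewrite rE sE -[RHS]dQ; ring.
(* p and q are the arguments of the entries Q 0 0 and Q 1 0. *)
exists (q - p), (h * 2), (- (p + q)).
pose g := (q - p) / 2; pose k := - (p + q) / 2.
have pE : p = - (g + k) by rewrite /g /k; field.
have qE : q = g - k by rewrite /g /k; field.
rewrite xE yE -hc pE cosN sinN cosD sinD in a_E.
rewrite uE vE -hs qE cosD sinD cosN sinN in c_E.
apply/matrixP; apply: ord2P; apply: ord2P.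
all: rewrite ?b_E ?d_E ?a_E ?c_E.
all: rewrite !mxE !big_ord_recr big_ord0 /= !mxE /= !big_ord_recr !big_ord0 /= !mxE /=.
all: rewrite mulfK // -/g -/k.
all: apply/eqP; rewrite eq_complex /=; apply/andP; split; apply/eqP; ring.
Qed.

(** Spherical coordinates of the last column give rotations about [z] and [y]
    that carry it back to the [z] axis; what remains fixes this axis, hence is a
    rotation about it. *)
Lemma SO3_euler (Q : 'M[R]_3) : @in_group R SO3 Q ->
  exists a b c, Q = rotz SO3 a * (roty SO3 b * rotz SO3 c).
Proof.
move=> Q_in; have [QQ _] := Q_in.
have col2 : Q 0 2%R ^+ 2 + Q 1 2%R ^+ 2 + Q 2%R 2%R ^+ 2 = 1.
  have := congr1 (fun A : 'M[R]_3 => A 2%R 2%R) (mulmx1C QQ).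
  have [a ->] := matrix_nat_entries Q.
  by rewrite !mxE !big_ord_recr big_ord0 /= !mxE /= => h; apply: etrans h; ring.
have [r [t [_ rE xE yE]]] := polar_coords (Q 0 2%R) (Q 1 2%R).
have [|b [bc bs]] := @polar_angle _ (Q 2%R 2%R) r; first by rewrite addrC rE.
(* Undo the rotations that carry the z axis to the last column of Q. *)
pose P : 'M[R]_3 := roty SO3 (- b) * (rotz SO3 (- t) * Q).
have P_in : @in_group R SO3 P.
  by do 2 (apply: in_groupM; first by [exact: in_group_rotz | exact: in_group_roty]).
suff [c cE] : exists c, P = rotz SO3 c.
  exists t, b, c; rewrite -cE /P !mulrA -[_ * roty _ b * _]mulrA -rotyD subrr roty0.
  by rewrite mulr1 -rotzD subrr rotz0 mul1r.
have [PP dP] := P_in.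
have P02 : P 0 2%R = 0.
  rewrite /P; move: xE yE bc bs; have [a ->] := matrix_nat_entries Q.
  rewrite !mxE !big_ord_recr !big_ord0 /= !mxE /= !big_ord_recr !big_ord0 /= !mxE /=.
  move=> -> -> <- <-; rewrite !cosN !sinN.
  transitivity (cos b * sin b * (cos t ^+ 2 + sin t ^+ 2 - 1)); first by ring.
  by rewrite cos2Dsin2 subrr mulr0.
have P12 : P 1 2%R = 0.
  rewrite /P; move: xE yE bc bs; have [a ->] := matrix_nat_entries Q.
  rewrite !mxE !big_ord_recr !big_ord0 /= !mxE /= !big_ord_recr !big_ord0 /= !mxE /=.
  move=> -> -> <- <-; rewrite !cosN !sinN; ring.
have P22 : P 2%R 2%R = 1.
  rewrite /P; move: xE yE bc bs; have [a ->] := matrix_nat_entries Q.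
  rewrite !mxE !big_ord_recr !big_ord0 /= !mxE /= !big_ord_recr !big_ord0 /= !mxE /=.
  move=> -> -> <- <-; rewrite !cosN !sinN.
  transitivity (cos b ^+ 2 + sin b ^+ 2 * (cos t ^+ 2 + sin t ^+ 2)); first by ring.
  by rewrite cos2Dsin2 mulr1 cos2Dsin2.
clearbody P; have adjE := right_inverse_adj PP dP.
have [] := adj_mx33_entries P; rewrite -adjE !mxE P02 P12 P22.
rewrite !mul0r !mulr0 !mulr1 subrr subr0 sub0r => P00 P01 P20 P21.
move: dP; rewrite det_mx33 P02 P12 P22 P20 P21 => dP.
have [|c [cc cs]] := @polar_angle _ (P 0 0) (P 1 0).
  by rewrite -[RHS]dP -P00 P01; ring.
exists c; apply/matrixP; apply: ord3P; apply: ord3P; rewrite !mxE /= ?cc ?cs //.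
Qed.

Lemma euler_angles G (Q : ambient R G) : in_group Q ->
  exists a b c, Q = rotz G a * (roty G b * rotz G c).
Proof. by case: G Q; [exact: SU2_euler | exact: SO3_euler]. Qed.

End EulerAngles.

(** * Products of sums and the action of the infinitesimal rotations *)

(** Distributivity when the index set depends on the factor.  The products of basis
    functions have their values in an algebra, so the order of the factors is kept. *)
Lemma prod_sum_dffun (S : nzSemiRingType) (J : finType) (T_ : J -> finType)
    (F : forall i, T_ i -> S) :
  \prod_i \sum_(k : T_ i) F i k
  = \sum_(f : {dffun forall i, T_ i}) \prod_i F i (f i).
Proof.
pose P i : {ffun T_ i -> S} := [ffun k => F i k].
rewrite (reindex (@dffun_of_fprod _ T_)) /=; last first.
  exact/onW_bij/dffun_of_fprod_bij.
transitivity (\sum_(t : fprod T_) \prod_(i in J) P i (t i)); last first.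
  by apply: eq_bigr => t _; apply: eq_bigr => i _; rewrite !ffunE.
rewrite big_fprod -(bigA_distr_big_dep (fun i => tagged_with T_ i)
  (fun i x => untag 0 (P i) x)); apply: eq_bigr => i _.
rewrite -(big_tag (fun i k => P i k)).
by apply: eq_bigr => k _; rewrite ffunE.
Qed.

Section Derivation.
Variables (R : realType) (N : nat) (n : 'I_N -> nat).
Local Notation T := {dffun forall i : 'I_N, 'I_(n i).+1}.
Implicit Types (m : T) (v : T -> R[i]) (j : 'I_N).

Lemma set_atP m m' j (k : 'I_(n j).+1) :
  reflect (m' j = k /\ forall i, i != j -> m' i = m i) (m' == set_at m j k).
Proof.
apply: (iffP eqP) => [->|[mj mi]].
  split=> [|i nij]; last by rewrite set_at_neq.
  by rewrite ffunE eqxx inord_val.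
apply/ffunP => i; rewrite ffunE; case: eqVneq => [->|nij]; last exact: mi.
by rewrite inord_val.
Qed.

(** A derivation on the tensor product changes one component at a time.  The
    product of Kronecker deltas selects the tuples that agree with [m] outside
    the component [j], and these are parametrized by their value at [j]. *)
Lemma sum_derivation (X : forall j, 'M[R[i]]_((n j).+1)) v m :
  \sum_m' v m' * \sum_j X j (m' j) (m j) * \prod_(i | i != j) (m' i == m i)%:R
  = \sum_j \sum_(k < (n j).+1) X j k (m j) * v (set_at m j k).
Proof.
under eq_bigr do rewrite mulr_sumr.
rewrite exchange_big; apply: eq_bigr => j _ /=.
pose P m' := [forall i, (i != j) ==> (m' i == m i)].
transitivity (\sum_(m' | P m') X j (m' j) (m j) * v m').
  rewrite [RHS]big_mkcond; apply: eq_bigr => m' _; case: ifPn => [/forallP h|].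
    rewrite (_ : \prod_(i | _) _ = 1); first by rewrite mulr1 mulrC.
    by apply: big1 => i nij; have /implyP/(_ nij) -> := h i.
  rewrite negb_forall; case/existsP => i; rewrite negb_imply => /andP[nij ni].
  rewrite (_ : \prod_(i | _) _ = 0) ?mulr0 //.
  by rewrite (bigD1 i) //= (negbTE ni) mul0r.
rewrite (reindex_onto (fun k : 'I_(n j).+1 => set_at m j k) (fun m' => m' j)) /=.
  apply: eq_big => k; last by move=> _; rewrite ffunE eqxx inord_val.
  rewrite ffunE eqxx inord_val eqxx andbT; apply/forallP => i.
  by apply/implyP => nij; rewrite set_at_neq.
move=> m' /forallP h; apply/esym/eqP/set_atP; split=> // i nij.
by apply/eqP; have /implyP := h i; apply.
Qed.

(** The value [k] is allowed to fall outside the range, provided that the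
    coefficient vanishes there. *)
Lemma sum_ord_pick p (k : nat) (a : R[i]) (g : nat -> R[i]) :
  ((p < k)%N -> a = 0) ->
  \sum_(mu < p.+1) (if mu == k :> nat then a else 0) * g mu = a * g k.
Proof.
move=> a0; have [lt_k|/a0 ->] := leqP k p; last first.
  by rewrite mul0r big1 // => mu _; case: ifP; rewrite mul0r.
rewrite (bigD1 (inord k)) //= inordK // eqxx big1 ?addr0 // => mu nmu.
case: eqP => [mk|]; last by rewrite mul0r.
by case/eqP: nmu; apply: val_inj; rewrite /= inordK.
Qed.

End Derivation.

Section SpinMatrices.
Variables (R : realType) (G : rot_group) (l : spin G).

Lemma dDyE (mu m : Mspin l) : dDy R l mu m =
  (if mu.+1 == m :> nat then (2^-1 * ladder R (twice l) m)%:C else 0)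
  - (if mu == m.+1 :> nat then (2^-1 * ladder R (twice l) m.+1)%:C else 0).
Proof.
rewrite mxE /mval /ell /= (_ : (_ == _ + 1) = (mu.+1 == m)); last first.
  by rewrite addrAC (inj_eq (addIr _)) natr1 eqr_nat eq_sym.
rewrite (_ : (_ == _ - 1) = (mu == m.+1 :> nat)); last first.
  by rewrite -(inj_eq (addIr 1)) subrK addrAC (inj_eq (addIr _)) natr1 eqr_nat eq_sym.
case: eqP => [mE|_].
  rewrite ifF ?subr0; last by apply/eqP; lia.
  by congr ((_ * Num.sqrt _)%:C); field.
case: eqP => [mE|_]; last by rewrite subr0.
rewrite sub0r -rmorphN; congr ((- (_ * Num.sqrt _))%:C).
by rewrite -natr1; field.
Qed.

Lemma dDy_antisym (mu m : Mspin l) : dDy R l mu m = - dDy R l m mu.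
Proof.
rewrite !dDyE opprB; congr (_ - _).
  by rewrite eq_sym; case: eqP => // ->.
by rewrite eq_sym; case: eqP => // <-.
Qed.

(** The infinitesimal rotation about [y] is half the difference of the two
    ladder operators. *)
Lemma sum_dDy (m : Mspin l) (g : nat -> R[i]) :
  \sum_mu dDy R l mu m * g mu =
  2^-1 * ((ladder R (twice l) m)%:C * g m.-1 - (ladder R (twice l) m.+1)%:C * g m.+1).
Proof.
under eq_bigr do rewrite dDyE mulrBl.
rewrite sumrB sum_ord_pick; last first.
  move=> le_m; have -> : m.+1 = (twice l).+1 by have := ltn_ord m; lia.
  by rewrite ladder_top mulr0.
rewrite mulrBr; congr (_ - _); last first.
  by rewrite rmorphM mulrA fmorphV rmorph_nat.
have [m0|m_gt0] := posnP m.
  by rewrite m0 ladder0 big1 ?mul0r ?mulr0 // => mu _; rewrite /= mul0r.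
rewrite (eq_bigr (fun mu : Mspin l => (if mu == m.-1 :> nat
    then (2^-1 * ladder R (twice l) m)%:C else 0) * g mu)); last first.
  by move=> mu _; rewrite -[in RHS]eqSS prednK.
rewrite sum_ord_pick; last by have := ltn_ord m; lia.
by rewrite rmorphM mulrA fmorphV rmorph_nat.
Qed.

Lemma sum_dDz (m : Mspin l) (g : nat -> R[i]) :
  \sum_mu dDz R l mu m * g mu = - ('i * (mval R m)%:C) * g m.
Proof.
rewrite (bigD1 m) //= mxE eqxx mulr1 big1 ?addr0 // => mu nmu.
by rewrite mxE (negbTE nmu) mulr0 mul0r.
Qed.
End SpinMatrices.

(** * The matrix M^up as a raising and lowering condition *)

Section MupAction.
Variables (R : realType) (G : rot_group) (I : Type) (comp : I -> spin G).
Variables (N : nat) (l : 'I_N -> I) (L : spin G).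
Local Notation n := (fun i : 'I_N => twice (comp (l i))).
Local Notation T := (Mtuple comp l).
Local Notation weight := (@weight R N n).
Local Notation raising := (@raising R N n).
Local Notation lowering := (@lowering R N n).
Local Notation lam := (weight_ladder (twice L)).
Implicit Types (m : T) (v : T -> R[i]) (j : 'I_N).

Lemma mtsumE m : mtsum R m = weight m.
Proof. by []. Qed.

Lemma shifted_upE m m' j :
  shifted (1 : R) m m' j = (m j < n j)%N && (m' == set_at m j (m j).+1).
Proof.
apply/forallP/andP => [h|[lt_m /eqP->] i]; last first.
  rewrite ffunE; case: (eqVneq i j) => [->|nij]; last by rewrite addr0.
  by rewrite /mval inordK // -natr1 addrAC.
have mj : m' j = (m j).+1 :> nat.
  have := h j; rewrite eqxx /mval addrAC (inj_eq (addIr _)) natr1 eqr_nat.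
  by move/eqP.
have lt_m : (m j < n j)%N by rewrite -ltnS -mj ltn_ord.
split=> //; have -> : (m j).+1 = @inord (n j) (m j).+1 by rewrite inordK.
apply/set_atP; split=> [|i nij]; first by apply: val_inj; rewrite /= inordK.
by have := h i; rewrite (negbTE nij) addr0 (inj_eq (addIr _)) eqr_nat => /eqP/val_inj.
Qed.

Lemma shifted_sym m m' j : shifted (-1 : R) m m' j = shifted (1 : R) m' m j.
Proof.
apply: eq_forallb => i; case: (eqVneq i j) => _; last by rewrite !addr0 eq_sym.
by rewrite -[RHS]subr_eq eq_sym.
Qed.

Lemma shifted_downE m m' j :
  shifted (-1 : R) m m' j = (0 < m j)%N && (m' == set_at m j (m j).-1).
Proof.
rewrite shifted_sym shifted_upE; apply/andP/andP => -[lt_m /eqP mE].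
  have mj : m j = (m' j).+1 :> nat by rewrite mE set_at_eq.
  by rewrite mj; split=> //; rewrite mE set_at_set /= set_at_id.
have le_m : ((m j).-1 <= n j)%N by rewrite (leq_trans (leq_pred _)) // -ltnS.
have mj : m' j = (m j).-1 :> nat by rewrite mE set_at_eq.
have lt_m' : ((m j).-1 < n j)%N by rewrite prednK // -ltnS.
split; first by rewrite mj.
by rewrite mj prednK // mE set_at_set set_at_id.
Qed.

Lemma shifted_inj (e : R) m m' j j' :
  e != 0 -> shifted e m m' j -> shifted e m m' j' -> j' = j.
Proof.
move=> e0 /forallP/(_ j) h /forallP/(_ j) h'; apply/eqP; apply: contraTT h' => nj.
rewrite (eqP h) eqxx [j == j']eq_sym (negbTE nj) (inj_eq (addrI _)).
exact: e0.
Qed.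

Lemma shifted_weight (e : R) m m' j : shifted e m m' j -> weight m' = weight m + e.
Proof.
move=> /forallP h; rewrite -!mtsumE /mtsum (eq_bigr _ (fun i _ => eqP (h i))).
by rewrite big_split /= -big_mkcond big_pred1_eq.
Qed.

(** Matrix elements of the lowering operator.  A sum over positions replaces the
    choice of a position in the entries of [M^up]; it has at most one nonzero
    term. *)
Definition up_kernel m m' : R :=
  \sum_(j | shifted (1 : R) m m' j) ladder R (n j) (m j).+1.

Definition down_kernel m m' : R :=
  \sum_(j | shifted (-1 : R) m m' j) ladder R (n j) (m j).

Lemma down_kernel_tr m m' : down_kernel m m' = up_kernel m' m.
Proof.
rewrite /down_kernel /up_kernel; apply: eq_big => j; first exact: shifted_sym.
by rewrite shifted_sym shifted_upE => /andP[lt_m /eqP ->]; rewrite set_at_eq.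
Qed.

Lemma up_kernel_weight m m' : weight m' != weight m + 1 -> up_kernel m m' = 0.
Proof.
by move=> nw; rewrite /up_kernel big_pred0 // => j; apply: contraNF nw => /shifted_weight ->.
Qed.

Lemma down_kernel_weight m m' : weight m' != weight m - 1 -> down_kernel m m' = 0.
Proof.
by move=> nw; rewrite /down_kernel big_pred0 // => j; apply: contraNF nw => /shifted_weight ->.
Qed.

Lemma sum_up_kernel v m : \sum_m' (up_kernel m m')%:C * v m' = lowering v m.
Proof.
under eq_bigr do rewrite /up_kernel rmorph_sum mulr_suml big_mkcond.
rewrite exchange_big; apply: eq_bigr => j _ /=.
rewrite -big_mkcond /=; under eq_bigl do rewrite shifted_upE.
have [lt_m|le_m] := ltnP (m j) (n j); first by rewrite big_pred1_eq.
have -> : (m j).+1 = (n j).+1.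
  by congr _.+1; apply/eqP; rewrite eqn_leq le_m -ltnS ltn_ord.
by rewrite big_pred0 // ladder_top mul0r.
Qed.

Lemma sum_down_kernel v m : \sum_m' (down_kernel m m')%:C * v m' = raising v m.
Proof.
under eq_bigr do rewrite /down_kernel rmorph_sum mulr_suml big_mkcond.
rewrite exchange_big; apply: eq_bigr => j _ /=.
rewrite -big_mkcond /=; under eq_bigl do rewrite shifted_downE.
have [m0|m_gt0] := posnP (m j); last by rewrite big_pred1_eq.
by rewrite big_pred0 // m0 ladder0 mul0r.
Qed.

Lemma pick_unique (P : pred 'I_N) (A : 'I_N -> R) :
  (forall j j', P j -> P j' -> j' = j) ->
  (if [pick j | P j] is Some j then A j else 0) = \sum_(j | P j) A j.
Proof.
move=> Pu; case: pickP => [j Pj|P0]; last by rewrite big_pred0.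
rewrite (big_pred1 j) // => j'; apply/idP/eqP => [|->//].
exact: Pu.
Qed.

(** The weight conditions in the definition of the entries are implied by the
    shifts, so they reduce to the distinction of the last row block. *)
Lemma Mup_entryE m m' : Mup_entry R L m m' =
  if weight m == ell R L + 1 then down_kernel m m'
  else lam (weight m + 1) * (m == m')%:R - up_kernel m m'.
Proof.
rewrite /Mup_entry !mtsumE; case: (eqVneq (weight m) _) => [wm|wm].
  case: (eqVneq (weight m') _) => [wm'|nwm'].
    rewrite pick_unique; last by move=> j j'; apply: shifted_inj; rewrite oppr_eq0 oner_eq0.
    by apply: eq_bigr => j _; congr Num.sqrt; rewrite /mval /ell; field.
  by rewrite down_kernel_weight // wm addrK.
case: (eqVneq (weight m') (weight m)) => [ww|nww].
  rewrite up_kernel_weight ?subr0; last first.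
    by rewrite ww -subr_eq0 opprD addNKr oppr_eq0 oner_eq0.
  by congr (_ * _); congr Num.sqrt; rewrite /ell; ring.
rewrite (_ : (m == m') = false) ?mulr0 ?sub0r; last first.
  by apply: contraNF nww => /eqP ->.
case: (eqVneq (weight m') _) => [wm'|nwm']; last by rewrite up_kernel_weight ?oppr0.
rewrite /up_kernel -pick_unique; last by move=> j j'; apply: shifted_inj; rewrite oner_eq0.
case: pickP => [j _|]; last by rewrite oppr0.
by congr (- Num.sqrt _); rewrite /mval /ell -natr1; field.
Qed.

Lemma Mup_entry_sum v m : \sum_m' (Mup_entry R L m m')%:C * v m' =
  if weight m == ell R L + 1 then raising v m
  else (lam (weight m + 1))%:C * v m - lowering v m.
Proof.
under eq_bigr do rewrite Mup_entryE.
case: eqP => _; first exact: sum_down_kernel.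
under eq_bigr do rewrite rmorphB mulrBl rmorphM.
rewrite sumrB sum_up_kernel (bigD1 m) //= eqxx mulr1 big1 ?addr0 // => m' nm.
by rewrite eq_sym (negbTE nm) rmorph0 mulr0 mul0r.
Qed.

Lemma Mup_entry_tsum v m' : \sum_m v m * (Mup_entry R L m m')%:C =
  lowering (fun m => if weight m == ell R L + 1 then v m else 0) m'
  + (lam (weight m' + 1))%:C * (if weight m' == ell R L + 1 then 0 else v m')
  - raising (fun m => if weight m == ell R L + 1 then 0 else v m) m'.
Proof.
rewrite -sum_up_kernel -sum_down_kernel.
rewrite (_ : _%:C * _ = \sum_m (lam (weight m + 1))%:C
   * (if weight m == ell R L + 1 then 0 else v m) * (m == m')%:R); last first.
  rewrite (bigD1 m') //= eqxx mulr1 big1 ?addr0 // => m nm.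
  by rewrite (negbTE nm) mulr0.
rewrite -big_split -sumrB; apply: eq_bigr => m _ /=.
rewrite Mup_entryE -[up_kernel m' m]down_kernel_tr [down_kernel m' m]down_kernel_tr.
case: eqP => _; first by rewrite !mulr0 mul0r subr0 addr0 mulrC.
rewrite mulr0 add0r rmorphB rmorphM rmorph_nat mulrBr [v m * (up_kernel _ _)%:C]mulrC.
by rewrite mulrA [v m * _]mulrC.
Qed.
End MupAction.

Section ExtendByZero.
Variables (K : nzRingType) (T : finType) (A : {set T}).
Implicit Types (u : 'I_#|A| -> K) (m : T).

(** Vectors indexed by an enumerated subset become functions on the whole type,
    which the operators above can be applied to. *)
Definition extend0 u m : K := \sum_(j < #|A| | enum_val j == m) u j.

Lemma extend0_val u j : extend0 u (enum_val j) = u j.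
Proof.
rewrite /extend0 (big_pred1 j) // => k.
by rewrite (inj_eq enum_val_inj).
Qed.

Lemma extend0_out u m : m \notin A -> extend0 u m = 0.
Proof.
move=> mA; rewrite /extend0 big_pred0 // => j; apply: contraNF mA => /eqP <-.
exact: enum_valP.
Qed.

Lemma extend0_sum (V : lmodType K) (F : T -> V) u :
  \sum_(j < #|A|) u j *: F (enum_val j) = \sum_m extend0 u m *: F m.
Proof.
rewrite (partition_big (fun j => enum_val j) xpredT) //=.
apply: eq_bigr => m _; rewrite scaler_suml.
by apply: eq_bigr => j /eqP ->.
Qed.
End ExtendByZero.

Section Kernel.
Variables (R : realType) (G : rot_group) (I : Type) (comp : I -> spin G).
Variables (N : nat) (l : 'I_N -> I) (L : spin G).
Local Notation n := (fun i : 'I_N => twice (comp (l i))).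
Local Notation T := (Mtuple comp l).
Local Notation weight := (@weight R N n).
Local Notation raising := (@raising R N n).
Local Notation lowering := (@lowering R N n).
Local Notation nL := (twice L).
Local Notation lam := (weight_ladder nL).
Local Notation cols := (MleL R comp l L).
Local Notation rows := (Mrows R comp l L).
Implicit Types (m : T) (v : T -> R[i]).

Lemma mem_MK (x : R) m : (m \in MK comp l x) = (weight m == x).
Proof. by rewrite inE mtsumE. Qed.

Lemma MleLP m :
  reflect (exists2 k, (k <= nL)%N & weight m = k%:R - ell R L) (m \in cols).
Proof.
apply: (iffP bigcupP) => [[K _]|[k le_k wm]].
  by rewrite mem_MK => /eqP wm; exists K => //; rewrite -ltnS.
exists (inord k : Mspin L) => //; rewrite mem_MK wm /mval inordK //.
Qed.

Lemma MrowsP m :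
  reflect ((exists2 k, (k < nL)%N & weight m = k%:R - ell R L)
           \/ weight m = ell R L + 1) (m \in rows).
Proof.
have mval_lt (K : Mspin L) : (mval R K < ell R L) = (K < nL)%N.
  by rewrite /mval ltrBlDr /ell -splitr ltr_nat.
rewrite inE mem_MK; apply: (iffP orP) => -[H|/eqP]; [left| by right | left| by right].
  case/bigcupP: H => K; rewrite mval_lt mem_MK => lt_K /eqP wm.
  by exists K.
case: H => k lt_k wm; apply/bigcupP; exists (inord k : Mspin L).
  by rewrite mval_lt inordK // ltnS ltnW.
by rewrite mem_MK wm /mval inordK // ltnS ltnW.
Qed.

Lemma weight_top_neq m k : (k <= nL)%N -> weight m = k%:R - ell R L ->
  weight m == ell R L + 1 = false.
Proof.
move=> le_k ->; apply/eqP => h; have : k%:R <= nL%:R :> R by rewrite ler_nat.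
by move: h; rewrite /ell; lra.
Qed.

(** Each row of [M^up] is one of the string equations at the tuple that indexes it. *)
Lemma kerMupP (c : 'cV[R[i]]_#|cols|) (v := extend0 (fun j => c j 0)) :
  c \in kerMup R comp l L <->
  (forall m k, (k < nL)%N -> weight m = k%:R - ell R L ->
     lowering v m = (lam (weight m + 1))%:C * v m) /\
  (forall m, weight m = ell R L + 1 -> raising v m = 0).
Proof.
have rowE i : (Mup R comp l L *m c) i 0 =
    if weight (enum_val i) == ell R L + 1 then raising v (enum_val i)
    else (lam (weight (enum_val i) + 1))%:C * v (enum_val i)
         - lowering v (enum_val i).
  rewrite mxE -Mup_entry_sum.
  under [RHS]eq_bigr do rewrite mulrC.
  rewrite -(extend0_sum (V := R[i]^o) (fun m => (Mup_entry R L (enum_val i) m)%:C)).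
  by apply: eq_bigr => j _; rewrite mxE mulrC.
rewrite memv_ker lfunE /=; split=> [/eqP c0|[low top]].
  split=> [m k lt_k wm|m wm].
    have mr : m \in rows by apply/MrowsP; left; exists k.
    have := rowE (enum_rank_in mr m); rewrite enum_rankK_in // c0 mxE.
    by rewrite (weight_top_neq (ltnW lt_k) wm) => /esym/eqP; rewrite subr_eq0 => /eqP.
  have mr : m \in rows by apply/MrowsP; right.
  have := rowE (enum_rank_in mr m); rewrite enum_rankK_in // c0 mxE.
  by rewrite wm eqxx.
apply/eqP/matrixP => i z; rewrite (ord1 z) rowE mxE.
have /MrowsP[[k lt_k wm]|wm] := enum_valP i; last by rewrite wm eqxx top.
by rewrite (weight_top_neq (ltnW lt_k) wm) (low _ _ lt_k wm) subrr.
Qed.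

(** A vector of coefficients of the rows that combines them to zero vanishes
    block by block: in the columns of weight below [L], the diagonal block is an
    invertible scalar and the other contribution comes from the block before.
    In the last column block only the lowering of the part of weight [L+1] is
    left, and lowering is injective on positive weights. *)
Lemma Mup_row_free : row_free (Mup R comp l L).
Proof.
apply: inj_row_free => u u0; pose v := extend0 (fun i => u 0 i).
have colE m : m \in cols ->
    lowering (fun m => if weight m == ell R L + 1 then v m else 0) m
  + (lam (weight m + 1))%:C * (if weight m == ell R L + 1 then 0 else v m)
  - raising (fun m => if weight m == ell R L + 1 then 0 else v m) m = 0.
  move=> mc; rewrite -Mup_entry_tsum.
  rewrite -(extend0_sum (V := R[i]^o) (fun m' => (Mup_entry R L m' m)%:C)).
  have := congr1 (fun w : 'rV_ _ => w 0 (enum_rank_in mc m)) u0.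
  rewrite !mxE => h; apply: etrans h; apply: eq_bigr => i _.
  by rewrite mxE enum_rankK_in.
have step m k : (k < nL)%N -> weight m = k%:R - ell R L ->
    (forall m', weight m' = weight m - 1 -> v m' = 0) -> v m = 0.
  move=> lt_k wm v0; have mc : m \in cols by apply/MleLP; exists k => //; exact: ltnW.
  have := colE m mc; rewrite (weight_top_neq (ltnW lt_k) wm).
  rewrite (@lowering_local _ _ _ _ (fun=> 0)) ?lowering0 ?add0r; last first.
    move=> m' wm'; rewrite (@weight_top_neq m' k.+1) //.
    by rewrite wm' wm -natr1; ring.
  rewrite (@raising_local _ _ _ _ (fun=> 0)) ?raising0 ?subr0; last first.
    by move=> m' /v0 ->; case: ifP.
  have lam_neq0 : lam (weight m + 1) != 0.
    have k0 : 0 <= k%:R :> R by rewrite ler0n.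
    have : k%:R + 1 <= nL%:R :> R by rewrite natr1 ler_nat.
    by move=> kL; apply: weight_ladder_neq0; rewrite wm /ell; lra.
  by move/eqP; rewrite mulf_eq0 (fmorph_eq0 (real_complex R)) (negbTE lam_neq0) => /eqP.
have low0 k m : (k < nL)%N -> weight m = k%:R - ell R L -> v m = 0.
  elim: k m => [|k IH] m lt_k wm; apply: (step _ _ lt_k wm) => m' wm'.
    apply: extend0_out; apply/MrowsP.
    have L0 : 0 <= nL%:R :> R by rewrite ler0n.
    case=> [[k' _]|]; last by move: wm' wm; rewrite /ell; lra.
    by have := ler0n R k'; move: wm' wm; rewrite /ell; lra.
  by apply: IH; [exact: ltnW | rewrite wm' wm -natr1; ring].
have v0 m : v m = 0.
  apply: lowering_inj_pos => {}m.
    have [/MrowsP[[k lt_k wm]|wm _]|mr] := boolP (m \in rows).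
    - by rewrite (low0 _ _ lt_k wm) eqxx.
    - by rewrite wm /ell; have := ler0n R nL; lra.
    by rewrite /v extend0_out ?eqxx.
  have [wm|nwm] := eqVneq (weight m) (ell R L); last first.
    rewrite (@lowering_local _ _ _ _ (fun=> 0)) ?lowering0 // => m' wm'.
    have [/MrowsP[[k lt_k wk]|wk]|mr] := boolP (m' \in rows).
    - exact: (low0 _ _ lt_k wk).
    - by case/eqP: nwm; move: wm'; rewrite wk; lra.
    exact: extend0_out.
  have mc : m \in cols by apply/MleLP; exists nL => //; rewrite wm /ell; field.
  have := colE m mc; rewrite wm weight_ladder_top mul0r addr0.
  rewrite (@raising_local _ _ _ _ (fun=> 0)) ?raising0 ?subr0; last first.
    move=> m' wm'; case: ifP => // _.
    have [/MrowsP[[k lt_k wk]|wk]|mr] := boolP (m' \in rows).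
    - exact: (low0 _ _ lt_k wk).
    - by exfalso; move: wm'; rewrite wk wm; lra.
    exact: extend0_out.
  rewrite (@lowering_local _ _ _ _ v) // => m' wm'.
  by rewrite wm' wm eqxx.
apply/rowP => i; rewrite mxE -[LHS](extend0_val (fun i => u 0 i)).
exact: v0.
Qed.

(** Independent rows make the matrix surjective; apply the rank-nullity theorem. *)
Lemma dim_kerMup : (\dim (kerMup R comp l L) + #|rows| = #|cols|)%N.
Proof.
have [B MB] := row_freeP Mup_row_free.
have := limg_ker_dim (linfun (mulmx (Mup R comp l L))
  : 'Hom('cV[R[i]]_#|cols|, 'cV[R[i]]_#|rows|)) fullv.
rewrite capfv (_ : (_ @: _)%VS = fullv); last first.
  apply/vspaceP => w; rewrite memvf; apply/memv_imgP; exists (B *m w).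
    exact: memvf.
  by rewrite lfunE /= mulmxA MB mul1mx.
by rewrite !dimvf /dim /= !muln1.
Qed.

(** Rows and columns share the blocks of weight below [L] and differ only in
    the last one. *)
Lemma card_blocks :
  (#|cols| + #|MK comp l (ell R L + 1)|
   = #|rows| + #|MK comp l (ell R L)|)%N.
Proof.
pose S := \bigcup_(K : Mspin L | mval R K < ell R L) MK comp l (mval R K).
have colsE : cols = S :|: MK comp l (ell R L).
  apply/setP => m; rewrite finset.in_setU; apply/bigcupP/orP.
    case=> K _ mK; have [lt_K|ge_K] := ltP (mval R K) (ell R L).
      by left; apply/bigcupP; exists K.
    right; rewrite (_ : ell R L = mval R K) //; apply/eqP; rewrite eq_le ge_K.
    rewrite /mval lerBlDr /ell -splitr ler_nat -ltnS; exact: ltn_ord.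
  case=> [/bigcupP[K _ mK]|mL]; first by exists K.
  exists ord_max => //; rewrite (_ : mval R _ = ell R L) //.
  by rewrite /mval /ell /=; field.
have disj (x : R) : ell R L <= x -> [disjoint S & MK comp l x].
  move=> le_x; rewrite disjoint_subset; apply/fintype.subsetP => m /bigcupP[K lt_K].
  by rewrite !inE => /eqP ->; rewrite lt_eqF // (lt_le_trans lt_K).
rewrite colsE /Mrows -/S !cardsU !disjoint_setI0 ?cards0 ?subn0 ?disj //.
  by rewrite addnAC.
by rewrite lerDl.
Qed.
End Kernel.

(** * Intertwiners between a tensor product and one spin representation *)

Section Representation.
Variables (R : realType) (G : rot_group).
Variable D : forall l : spin G, ambient R G -> 'M[R[i]]_((twice l).+1).
Hypothesis hD : is_wignerD D.
Variables (I : Type) (comp : I -> spin G).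
Variables (N : nat) (l : 'I_N -> I) (L : spin G).
Local Notation n := (fun i : 'I_N => twice (comp (l i))).
Local Notation T := (Mtuple comp l).
Local Notation weight := (@weight R N n).
Local Notation raising := (@raising R N n).
Local Notation lowering := (@lowering R N n).
Local Notation nL := (twice L).
Local Notation lam := (weight_ladder nL).
Local Notation tup a := (enum_val a : T).
Implicit Types (m : T) (C : Mspin L -> T -> R[i]).

Definition tensor_rep (Q : ambient R G) : 'M[R[i]]_#|{: T}| :=
  \matrix_(a, b) \prod_i D (comp (l i)) Q (tup a i) (tup b i).

(** The derivative of the tensor product representation when its factors have
    the derivatives [X i]. *)
Definition tensor_derivation (X : forall i : 'I_N, 'M[R[i]]_((n i).+1)) :
    'M[R[i]]_#|{: T}| :=
  \matrix_(a, b) \sum_j X j ((tup a) j) ((tup b) j)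
     * \prod_(i | i != j) ((tup a) i == (tup b) i)%:R.

Definition coef_mx C : 'M[R[i]]_(nL.+1, #|{: T}|) :=
  \matrix_(K, a) C K (tup a).

Lemma sum_enum_val (V : nmodType) (F : T -> V) :
  \sum_(a < #|{: T}|) F (tup a) = \sum_m F m.
Proof. by rewrite -big_enum_val. Qed.

Lemma tensor_repM P Q : in_group P -> in_group Q ->
  tensor_rep (P * Q) = tensor_rep P *m tensor_rep Q.
Proof.
move=> hP hQ; apply/matrixP => a b; rewrite !mxE.
under eq_bigr => i _.
  have [_ DM _ _] := hD (comp (l i)); rewrite DM // mxE.
  over.
rewrite (@prod_sum_dffun _ _ (fun i => 'I_(n i).+1)
  (fun i k => D (comp (l i)) P (tup a i) k * D (comp (l i)) Q k (tup b i))).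
rewrite -sum_enum_val; apply: eq_bigr => c _.
by rewrite !mxE big_split.
Qed.

Lemma prod_delta (m m' : T) : \prod_i (m i == m' i)%:R = (m == m')%:R :> R[i].
Proof.
have [->|nm] := eqVneq m m'; first by rewrite big1 // => i _; rewrite eqxx.
have [i ni] : exists i, m i != m' i.
  apply/existsP; rewrite -negb_forall; apply: contra nm => /forallP h.
  by apply/eqP/ffunP => i; apply/eqP.
by rewrite (bigD1 i) //= (negbTE ni) mul0r.
Qed.

Lemma tensor_rep1 : tensor_rep 1 = 1%:M.
Proof.
apply/matrixP => a b; rewrite !mxE -(inj_eq enum_val_inj) -prod_delta.
apply: eq_bigr => i _; have [-> _ _ _] := hD (comp (l i)).
by rewrite mxE.
Qed.

Lemma tensor_rep_derive (g : R -> ambient R G)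
    (X : forall i : 'I_N, 'M[R[i]]_((n i).+1)) :
  g 0 = 1 -> (forall i, mx_derive0 (fun t => D (comp (l i)) (g t)) (X i)) ->
  mx_cderive 0 (fun t => tensor_rep (g t)) (tensor_derivation X).
Proof.
move=> g0 dg a b; rewrite mxE.
rewrite (_ : (fun t => _) =
  (fun t => \prod_i D (comp (l i)) (g t) (tup a i) (tup b i))); last first.
  by apply/funext => t; rewrite mxE.
have := @is_cderive_prod R 0 _
  (fun i t => D (comp (l i)) (g t) (tup a i) (tup b i))
  (fun i => X i ((tup a) i) ((tup b) i)) (fun i => dg i _ _).
congr is_cderive; apply: eq_bigr => j _; congr (_ * _); apply: eq_bigr => i _.
by rewrite g0; have [-> _ _ _] := hD (comp (l i)); rewrite mxE.
Qed.

Lemma intertwine_along C (g : R -> ambient R G)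
    (X : forall l : spin G, 'M[R[i]]_((twice l).+1)) :
  g 0 = 1 -> (forall s t, g (s + t) = g s * g t) -> (forall t, in_group (g t)) ->
  (forall l, mx_derive0 (fun t => D l (g t)) (X l)) ->
  (forall t, coef_mx C *m tensor_rep (g t) = D L (g t) *m coef_mx C) <->
  coef_mx C *m tensor_derivation (fun i => X (comp (l i))) = X L *m coef_mx C.
Proof.
move=> g0 gD gG dg; have [D1 DM _ _] := hD L.
apply: (intertwine_one_parameter (A := fun t => D L (g t))
  (B := fun t => tensor_rep (g t))).
- by rewrite g0.
- by rewrite g0 tensor_rep1.
- by move=> s t; rewrite gD DM.
- by move=> s t; rewrite gD tensor_repM.
- exact: dg.
- exact: tensor_rep_derive.
Qed.

(** Along each of the two one-parameter subgroups the relation is equivalent to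
    its derivative, and by Euler angles these subgroups generate the group. *)
Lemma intertwine_group C :
  (forall Q, in_group Q -> coef_mx C *m tensor_rep Q = D L Q *m coef_mx C) <->
  coef_mx C *m tensor_derivation (fun i => dDz R (comp (l i))) = dDz R L *m coef_mx C
  /\ coef_mx C *m tensor_derivation (fun i => dDy R (comp (l i))) = dDy R L *m coef_mx C.
Proof.
have alongz := @intertwine_along C (rotz G) (@dDz R G) (rotz0 R G) (@rotzD R G)
  (@in_group_rotz R G) (fun l => let: And4 _ _ dz _ := hD l in dz).
have alongy := @intertwine_along C (roty G) (@dDy R G) (roty0 R G) (@rotyD R G)
  (@in_group_roty R G) (fun l => let: And4 _ _ _ dy := hD l in dy).
split=> [CG|[/alongz Cz /alongy Cy] Q].
  split; [apply/alongz | apply/alongy] => t; apply: CG;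
    [exact: in_group_rotz | exact: in_group_roty].
case/euler_angles => a [b [c ->]].
have [_ DM _ _] := hD L.
have zG := @in_group_rotz R G; have yG := @in_group_roty R G.
have yzG := in_groupM (yG b) (zG c).
rewrite !tensor_repM // !DM // mulmxA Cz -[_ *m coef_mx C *m _]mulmxA.
by rewrite [coef_mx C *m _]mulmxA Cy -[_ *m coef_mx C *m _]mulmxA Cz !mulmxA.
Qed.

Lemma mul_tensor_derivation C X K a :
  (coef_mx C *m tensor_derivation X) K a =
  \sum_j \sum_k X j k ((tup a) j) * C K (set_at (tup a) j k).
Proof.
rewrite mxE -sum_derivation -sum_enum_val.
by apply: eq_bigr => b _; rewrite !mxE.
Qed.

(** Both sides are diagonal, with entries proportional to the weight of [m] and
    to [K]. *)
Lemma infinitesimal_z C :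
  coef_mx C *m tensor_derivation (fun i => dDz R (comp (l i))) = dDz R L *m coef_mx C
  <-> forall K m, weight m != mval R K -> C K m = 0.
Proof.
have lhsE K a : (coef_mx C *m tensor_derivation (fun i => dDz R (comp (l i)))) K a
    = - ('i * (weight (tup a))%:C) * C K (tup a).
  rewrite mul_tensor_derivation.
  transitivity (\sum_j - ('i * (mval R ((tup a) j))%:C) * C K (tup a)).
    apply: eq_bigr => j _; rewrite (sum_dDz _ (fun k => C K (set_at (tup a) j k))).
    by rewrite set_at_id.
  by rewrite -mulr_suml sumrN -mulr_sumr -rmorph_sum.
have rhsE K a : (dDz R L *m coef_mx C) K a = - ('i * (mval R K)%:C) * C K (tup a).
  rewrite mxE (bigD1 K) //= big1 ?addr0 => [|K' nK]; first by rewrite !mxE eqxx mulr1.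
  by rewrite mxE eq_sym (negbTE nK) mulr0 mul0r.
split=> [zE K m nw|C0].
  have := congr1 (fun A : 'M[R[i]]_(_, _) => A K (enum_rank m)) zE.
  rewrite lhsE rhsE enum_rankK => /eqP.
  rewrite -subr_eq0 -mulrBl mulf_eq0 -opprD oppr_eq0 -mulrN -mulrDr -rmorphN -rmorphD.
  rewrite mulf_eq0 (negbTE (neq0Ci _)) (fmorph_eq0 (real_complex R)) subr_eq0.
  by rewrite (negbTE nw) => /eqP.
apply/matrixP => K a; rewrite lhsE rhsE.
have [->//|nw] := eqVneq (weight (tup a)) (mval R K).
by rewrite C0 // !mulr0.
Qed.

(** The minus sign on the right comes from the antisymmetry of the infinitesimal
    rotation about [y], because [K] is the row index there. *)
Lemma infinitesimal_y C :
  coef_mx C *m tensor_derivation (fun i => dDy R (comp (l i))) = dDy R L *m coef_mx C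
  <-> forall (K : Mspin L) m, raising (C K) m - lowering (C K) m
    = (ladder R nL K.+1)%:C * C (inord K.+1) m - (ladder R nL K)%:C * C (inord K.-1) m.
Proof.
have lhsE K a : (coef_mx C *m tensor_derivation (fun i => dDy R (comp (l i)))) K a
    = 2^-1 * (raising (C K) (tup a) - lowering (C K) (tup a)).
  rewrite mul_tensor_derivation /raising /lowering -sumrB mulr_sumr.
  apply: eq_bigr => j _.
  by rewrite (sum_dDy _ (fun k => C K (set_at (tup a) j k))).
have rhsE (K : Mspin L) a : (dDy R L *m coef_mx C) K a = 2^-1 *
   ((ladder R nL K.+1)%:C * C (inord K.+1) (tup a)
    - (ladder R nL K)%:C * C (inord K.-1) (tup a)).
  rewrite mxE -[RHS]opprK -mulrN opprB.
  rewrite -(sum_dDy K (fun k => C (inord k) (tup a))) -sumrN.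
  apply: eq_bigr => K' _.
  by rewrite dDy_antisym mulNr inord_val [coef_mx _ _ _]mxE opprK.
split=> [yE K m|yE].
  have := congr1 (fun A : 'M[R[i]]_(_, _) => A K (enum_rank m)) yE.
  by rewrite lhsE rhsE enum_rankK => h; apply: mulfI h; rewrite invr_eq0 pnatr_eq0.
by apply/matrixP => K a; rewrite lhsE rhsE yE.
Qed.

End Representation.

Section Intertwiners.
Variables (R : realType) (G : rot_group).
Variable D : forall l : spin G, ambient R G -> 'M[R[i]]_((twice l).+1).
Hypothesis hD : is_wignerD D.
Variables (I : Type) (comp : I -> spin G).
Variables (N : nat) (l : 'I_N -> I) (L : spin G).
Local Notation n := (fun i : 'I_N => twice (comp (l i))).
Local Notation T := (Mtuple comp l).
Local Notation weight := (@weight R N n).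
Local Notation raising := (@raising R N n).
Local Notation lowering := (@lowering R N n).
Local Notation nL := (twice L).
Local Notation lam := (weight_ladder nL).
Implicit Types (m : T) (v : T -> R[i]) (C : Mspin L -> T -> R[i]).

Definition weight_parts v (K : Mspin L) m : R[i] :=
  if weight m == mval R K then v m else 0.

Lemma raising_part v K m : raising (weight_parts v K) m =
  if weight m == mval R K + 1 then raising v m else 0.
Proof.
case: eqP => wm; [|rewrite -[RHS](@raising0 R N n m)]; apply: raising_local => m' wm'.
  by rewrite /weight_parts wm' wm addrK eqxx.
by rewrite /weight_parts ifF //; apply/eqP => wK; apply: wm; rewrite -wK wm' subrK.
Qed.

Lemma lowering_part v K m : lowering (weight_parts v K) m =
  if weight m == mval R K - 1 then lowering v m else 0.
Proof.
case: eqP => wm; [|rewrite -[RHS](@lowering0 R N n m)]; apply: lowering_local => m' wm'.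
  by rewrite /weight_parts wm' wm subrK eqxx.
by rewrite /weight_parts ifF //; apply/eqP => wK; apply: wm; rewrite -wK wm' addrK.
Qed.

(** The ladder coefficient of spin [L] vanishes at [K = L], where [inord K.+1] is
    a junk index. *)
Lemma weight_parts_succ v (K : Mspin L) m :
  (ladder R nL K.+1)%:C * weight_parts v (inord K.+1) m =
  if weight m == mval R K + 1 then (lam (weight m))%:C * v m else 0.
Proof.
have wE : weight m = mval R K + 1 -> lam (weight m) = ladder R nL K.+1.
  by move=> ->; rewrite -weight_ladderE /mval /ell -natr1; congr weight_ladder; ring.
have := ltn_ord K; rewrite ltnS leq_eqVlt => /predU1P[KL|lt_K].
  rewrite KL ladder_top mul0r; case: eqP => // /wE ->.
  by rewrite KL ladder_top mul0r.
rewrite /weight_parts (_ : mval R (inord K.+1 : Mspin L) = mval R K + 1); last first.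
  by rewrite /mval inordK // -natr1; ring.
by case: eqP => [/wE ->|] //; rewrite mulr0.
Qed.

Lemma weight_parts_pred v (K : Mspin L) m :
  (ladder R nL K)%:C * weight_parts v (inord K.-1) m =
  if weight m == mval R K - 1 then (lam (weight m + 1))%:C * v m else 0.
Proof.
have wE : weight m = mval R K - 1 -> lam (weight m + 1) = ladder R nL K.
  by move=> ->; rewrite subrK weight_ladderE.
have [K0|K_gt0] := posnP K.
  rewrite K0 ladder0 mul0r; case: eqP => // /wE ->.
  by rewrite K0 ladder0 mul0r.
rewrite /weight_parts (_ : mval R (inord K.-1 : Mspin L) = mval R K - 1); last first.
  rewrite /mval inordK ?(leq_ltn_trans (leq_pred _)) //.
  by rewrite -[in RHS](prednK K_gt0) -natr1; ring.
by case: eqP => [/wE ->|] //; rewrite mulr0.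
Qed.

(** The equation for [X_2] compares the parts of weight [K + 1] and [K - 1]
    separately, and each comparison is one of the string equations. *)
Lemma string_intertwines v : highest_weight_string nL v ->
  forall Q, in_group Q ->
  coef_mx (weight_parts v) *m tensor_rep D comp l Q
  = D L Q *m coef_mx (weight_parts v).
Proof.
move=> v_string; apply/(intertwine_group hD); split.
  by apply/infinitesimal_z => K m; rewrite /weight_parts => /negbTE ->.
apply/infinitesimal_y => K m.
rewrite raising_part lowering_part weight_parts_succ weight_parts_pred.
by rewrite (raising_string v_string) (lowering_string v_string).
Qed.

(** Since row [K] is supported on weight [K], summing the rows loses no
    information.  The rows of weight [k + 1] of the [X_2] equation, read in weight
    [k], are the lowering equations, and the row [L], read in weight [L + 1], says
    that raising kills the top. *)
Lemma intertwiner_string C :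
  (forall Q, in_group Q ->
    coef_mx C *m tensor_rep D comp l Q = D L Q *m coef_mx C) ->
  exists2 v, highest_weight_string nL v & forall K m, C K m = weight_parts v K m.
Proof.
move=> /(intertwine_group hD)[/infinitesimal_z C0 /infinitesimal_y CE].
pose v m := \sum_K C K m.
have mval_inj (K K' : Mspin L) : mval R K = mval R K' -> K = K'.
  by move=> /addIr/eqP; rewrite eqr_nat => /eqP/val_inj.
have CvE K m : C K m = weight_parts v K m.
  rewrite /weight_parts; case: eqP => [wm|/eqP/C0 //].
  rewrite /v (bigD1 K) //= big1 ?addr0 // => K' nK; apply: C0.
  by rewrite wm; apply: contraNN nK => /eqP/mval_inj ->.
have partsE K m : raising (C K) m - lowering (C K) m =
    (if weight m == mval R K + 1 then (lam (weight m))%:C * v m else 0)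
    - (if weight m == mval R K - 1 then (lam (weight m + 1))%:C * v m else 0).
  by rewrite CE !CvE weight_parts_succ weight_parts_pred.
have raisingC K m : raising (C K) m =
    if weight m == mval R K + 1 then raising v m else 0.
  by rewrite -raising_part; apply: raising_local => m' _; rewrite CvE.
have loweringC K m : lowering (C K) m =
    if weight m == mval R K - 1 then lowering v m else 0.
  by rewrite -lowering_part; apply: lowering_local => m' _; rewrite CvE.
exists v => //; split=> [m vm|m k lt_k wm|m wm].
- have [K|noK] := pickP (fun K : Mspin L => weight m == mval R K).
    by move=> /eqP wm; exists K => //; rewrite -ltnS.
  by move: vm; rewrite /v big1 ?eqxx // => K _; apply: C0; rewrite noK.
- have wK : weight m = mval R (inord k.+1 : Mspin L) - 1.
    by rewrite wm /mval /ell inordK // -natr1; ring.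
  have nwK : weight m == mval R (inord k.+1 : Mspin L) + 1 = false.
    by apply/eqP; rewrite wK; lra.
  have := partsE (inord k.+1) m.
  by rewrite raisingC loweringC nwK -wK eqxx !sub0r => /oppr_inj.
have wK : weight m = mval R (ord_max : Mspin L) + 1.
  by rewrite wm /mval /ell /=; field.
have nwK : weight m == mval R (ord_max : Mspin L) - 1 = false.
  by apply/eqP; rewrite wK; lra.
have := partsE ord_max m.
rewrite raisingC loweringC nwK -wK eqxx !subr0 => ->.
by rewrite wm weight_ladder_top mul0r.
Qed.
End Intertwiners.

(** * Equivariant functions and their coefficients *)

Section InnerProduct.
Variables (R : realType) (V : lmodType R[i]) (H : V -> Prop).
Variable ip : V -> V -> R[i].
Hypothesis hip : is_inner_product H ip.

(** Linearity of the form holds only on [H], so membership in [H] is proved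
    together with the formula. *)
Lemma ip_suml (J : finType) (a : J -> R[i]) (v : J -> V) w :
  (forall j, H (v j)) -> H w ->
  H (\sum_j a j *: v j) /\ ip (\sum_j a j *: v j) w = \sum_j a j * ip (v j) w.
Proof.
case: hip => [[H0 Hlin] iplin _ _] Hv Hw.
apply: (big_ind2 (fun x b => H x /\ ip x w = b))
  => [|x1 x2 y1 y2 [Hx xE] [Hy yE]|j _].
- split=> //; have := iplin (-1) 0 0 w H0 H0 Hw.
  by rewrite scaler0 addr0 mulN1r addNr.
- split; first by rewrite -[x1]scale1r; exact: Hlin.
  by rewrite -[x1]scale1r iplin // mul1r xE yE.
split; first by rewrite -[_ *: _]addr0; exact: Hlin.
have ip0 : ip 0 w = 0.
  by have := iplin (-1) 0 0 w H0 H0 Hw; rewrite scaler0 addr0 mulN1r addNr.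
by rewrite -[_ *: _]addr0 iplin // ip0 addr0.
Qed.

(** Pairing with [v j] extracts the coefficient at [j]. *)
Lemma orthonormal_lin_indep (J : finType) (v : J -> V) :
  (forall j, H (v j)) -> (forall j k, ip (v j) (v k) = (j == k)%:R) -> lin_indep v.
Proof.
move=> Hv orth a a0 j; have [_] := ip_suml a Hv (Hv j).
have [_ ip0] := ip_suml (fun=> 0) Hv (Hv j).
rewrite a0 -[X in ip X _](_ : \sum_i (0 : R[i]) *: v i = 0); last first.
  by apply: big1 => i _; rewrite scale0r.
rewrite ip0 big1 => [|i _]; last by rewrite mul0r.
rewrite (bigD1 j) //= orth eqxx mulr1 big1 ?addr0 // => i ij.
by rewrite orth (negbTE ij) mulr0.
Qed.
End InnerProduct.

Section EquivariantFunctions.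
Variables (R : realType) (G : rot_group).
Variable D : forall l : spin G, ambient R G -> 'M[R[i]]_((twice l).+1).
Variables (Omega : Type) (act : ambient R G -> Omega -> Omega).
Variable F : algType R[i].
Variables (I : Type) (comp : I -> spin G).
Variable phi : forall l : I, Mspin (comp l) -> Omega -> F.
Hypothesis heqv : forall (l : I) (m : Mspin (comp l)) (Q : ambient R G) (r : Omega),
  in_group Q ->
  phi m (act Q r) = \sum_(m' : Mspin (comp l)) D (comp l) Q m m' *: phi m' r.
Variables (N : nat) (l : 'I_N -> I) (L : spin G).
Local Notation n := (fun i : 'I_N => twice (comp (l i))).
Local Notation T := (Mtuple comp l).
Hypothesis phi_indep : lin_indep (@phi_tuple R G Omega F I comp phi N l).
Implicit Types (m : T) (C : Mspin L -> T -> R[i]).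

Definition expansion C (K : Mspin L) : ('I_N -> Omega) -> F :=
  \sum_m C K m *: phi_tuple phi m.

Lemma expansion_val C K r :
  expansion C K r = \sum_m C K m *: phi_tuple phi m r.
Proof. by rewrite /expansion fct_sumE. Qed.

Lemma expansion_inj C C' K :
  (forall r, expansion C K r = expansion C' K r) -> forall m, C K m = C' K m.
Proof.
move=> CC m; apply/eqP; rewrite -subr_eq0; apply/eqP.
apply: (phi_indep (a := fun m => C K m - C' K m)).
under eq_bigr do rewrite scalerBl.
rewrite sumrB; apply/eqP; rewrite subr_eq0; apply/eqP.
by apply/funext => r; have := CC r; rewrite /expansion.
Qed.

Lemma phi_tuple_act m Q (r : 'I_N -> Omega) : in_group Q ->
  phi_tuple phi m (fun i => act Q (r i))
  = \sum_(m' : T) (\prod_i D (comp (l i)) Q (m i) (m' i)) *: phi_tuple phi m' r.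
Proof.
move=> hQ; rewrite /phi_tuple; under eq_bigr do rewrite heqv //.
rewrite (prod_sum_dffun (fun i (k : Mspin (comp (l i))) =>
  D (comp (l i)) Q (m i) k *: phi k (r i))).
by apply: eq_bigr => m' _; rewrite scaler_prod.
Qed.

Lemma expansion_act C K Q (r : 'I_N -> Omega) : in_group Q ->
  expansion C K (fun i => act Q (r i)) =
  expansion (fun K m => (coef_mx C *m tensor_rep D comp l Q) K (enum_rank m)) K r.
Proof.
move=> hQ; rewrite !expansion_val; under eq_bigr do rewrite phi_tuple_act // scaler_sumr.
rewrite exchange_big; apply: eq_bigr => m' _ /=.
rewrite mxE scaler_suml -sum_enum_val; apply: eq_bigr => a _.
by rewrite scalerA !mxE enum_rankK.
Qed.

Lemma expansion_mul C K (A : 'M[R[i]]_((twice L).+1)) r :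
  \sum_K' A K K' *: expansion C K' r =
  expansion (fun K m => (A *m coef_mx C) K (enum_rank m)) K r.
Proof.
rewrite expansion_val; under eq_bigr do rewrite expansion_val scaler_sumr.
rewrite exchange_big; apply: eq_bigr => m _ /=.
rewrite mxE scaler_suml; apply: eq_bigr => K' _.
by rewrite scalerA !mxE enum_rankK.
Qed.

Lemma VL_expansion C :
  VL phi l act D (expansion C) <->
  forall Q, in_group Q -> coef_mx C *m tensor_rep D comp l Q = D L Q *m coef_mx C.
Proof.
split=> [[_ CV] Q hQ|CV].
  apply/matrixP => K a; rewrite -[a]enum_valK.
  apply: (@expansion_inj
    (fun K m => (coef_mx C *m tensor_rep D comp l Q) K (enum_rank m))
    (fun K m => (D L Q *m coef_mx C) K (enum_rank m)) K _ (enum_val a)) => r.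
  by rewrite -expansion_act // CV // expansion_mul.
split=> [K|Q hQ r K]; first by exists (C K).
by rewrite expansion_act // expansion_mul CV.
Qed.

Lemma VL_exists_expansion f :
  VL phi l act D (L := L) f -> exists C, f = expansion C.
Proof.
case=> Vf _; have /choice[C CE] K : exists a : T -> R[i],
    f K = \sum_m a m *: phi_tuple phi m by exact: Vf.
by exists C; apply/funext => K; rewrite CE.
Qed.

Lemma bfun_expansion (c : 'cV[R[i]]_#|MleL R comp l L|) :
  bfun phi c = expansion (weight_parts (extend0 (fun j => c j 0))).
Proof.
apply/funext => K; apply/funext => r; rewrite expansion_val /bfun big_mkcond /=.
under eq_bigr do rewrite mem_MK.
rewrite [RHS](eq_bigr (fun m => extend0 (fun j => c j 0) m *:
   (if weight R m == mval R K then phi_tuple phi m r else 0))); last first.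
  by move=> m _; rewrite /weight_parts; case: ifP; rewrite ?scaler0 ?scale0r.
rewrite -extend0_sum; apply: eq_bigr => j _.
by case: ifP; rewrite ?scaler0.
Qed.
End EquivariantFunctions.

Section KernelStrings.
Variables (R : realType) (G : rot_group) (I : Type) (comp : I -> spin G).
Variables (N : nat) (l : 'I_N -> I) (L : spin G).
Local Notation T := (Mtuple comp l).
Local Notation cols := (MleL R comp l L).

Lemma kerMup_string (c : 'cV[R[i]]_#|cols|) :
  c \in kerMup R comp l L <->
  highest_weight_string (twice L) (extend0 (fun j => c j 0)).
Proof.
split=> [/kerMupP[low top]|[_ low top]]; last exact/kerMupP.
split=> // m; case: (boolP (m \in cols)) => [/MleLP//|mc].
by rewrite extend0_out ?eqxx.
Qed.

(** The support condition makes the values outside the columns vanish on both sides. *)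
Lemma string_column (v : T -> R[i]) : highest_weight_string (twice L) v ->
  exists2 c, c \in kerMup R comp l L & v = extend0 (fun j => c j 0).
Proof.
move=> vS; have [supp _ _] := vS.
pose c : 'cV[R[i]]_#|cols| := \col_j v (enum_val j).
suff vE : v = extend0 (fun j => c j 0).
  by exists c => //; apply/kerMup_string; rewrite -vE.
apply/funext => m; case: (boolP (m \in cols)) => [mc|mc].
  by rewrite -(enum_rankK_in mc mc) extend0_val mxE.
rewrite extend0_out //; apply/eqP; apply: contraNT mc => /supp vm.
exact/MleLP.
Qed.
End KernelStrings.

Section BasisFunctions.
Variables (R : realType) (G : rot_group) (Omega : Type) (F : algType R[i]).
Variables (I : Type) (comp : I -> spin G).
Variable phi : forall l : I, Mspin (comp l) -> Omega -> F.
Variables (N : nat) (l : 'I_N -> I) (L : spin G).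
Local Notation cols := (MleL R comp l L).
Hypothesis phi_indep : lin_indep (@phi_tuple R G Omega F I comp phi N l).

Lemma bfun_sum (J : finType) (a : J -> R[i]) (c : J -> 'cV[R[i]]_#|cols|) :
  bfun phi (\sum_i a i *: c i) = \sum_i a i *: bfun phi (c i).
Proof.
apply/funext => K; apply/funext => r; rewrite !fct_sumE /bfun.
rewrite [RHS](eq_bigr (fun i => \sum_(j < #|cols| | enum_val j \in MK comp l (mval R K))
  a i *: (c i j 0 *: phi_tuple phi (enum_val j) r))); last first.
  by move=> i _; rewrite -scaler_sumr.
rewrite exchange_big; apply: eq_bigr => j _ /=.
rewrite summxE scaler_suml; apply: eq_bigr => i _.
by rewrite mxE scalerA.
Qed.

Lemma bfun_eq0 (c : 'cV[R[i]]_#|cols|) : bfun phi c = 0 -> c = 0.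
Proof.
rewrite bfun_expansion => c0; apply/matrixP => j z; rewrite (ord1 z) mxE.
have /bigcupP[K _ mK] := enum_valP j.
rewrite -(extend0_val (fun j => c j 0)).
move: mK; rewrite mem_MK => wK; set v := extend0 _.
have <- : weight_parts v K (enum_val j) = v (enum_val j) by rewrite /weight_parts wK.
apply: (expansion_inj phi_indep (C' := fun _ _ => 0)) => r.
by rewrite c0 expansion_val big1 // => m _; rewrite scale0r.
Qed.
End BasisFunctions.


Unset Implicit Arguments.

Theorem proposition3p9
    (R : realType) (G : rot_group)
    (D : forall l : spin G, ambient R G -> 'M[R[i]]_((twice l).+1))
    (hD : is_wignerD D)
    (Omega : Type) (act : ambient R G -> Omega -> Omega)
    (hact : is_action act)
    (F : algType R[i])
    (d : Order.disp_t) (I : orderType d) (comp : I -> spin G)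
    (phi : forall l : I, Mspin (comp l) -> Omega -> F)
    (H : (Omega -> F) -> Prop) (ip : (Omega -> F) -> (Omega -> F) -> R[i])
    (hip : is_inner_product H ip)
    (hH : forall (l : I) (m : Mspin (comp l)), H (phi l m))
    (horth : forall (l l' : I) (m : Mspin (comp l)) (m' : Mspin (comp l')),
       ip (phi l m) (phi l' m') = ((l == l') && (m == m' :> nat))%:R)
    (heqv : forall (l : I) (m : Mspin (comp l)) (Q : ambient R G) (r : Omega),
       in_group Q ->
       phi l m (act Q r) = \sum_(m' : Mspin (comp l)) D (comp l) Q m m' *: phi l m' r)
    (N : nat) (hN : (0 < N)%N) (l : 'I_N -> I)
    (htensor : tensor_faithful phi l)
    (L : spin G) :
  (forall c : (\dim (kerMup R comp l L)).-tuple 'cV[R[i]]_#|MleL R comp l L|,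
     basis_of (kerMup R comp l L) c ->
     is_basis (VL phi l act D (L := L)) (fun i => bfun phi (tnth c i)))
  /\ has_dim (VL phi l act D (L := L)) (\dim (kerMup R comp l L))
  /\ (\dim (kerMup R comp l L))%:Z
     = #|MK comp l (ell R L)|%:Z - #|MK comp l (ell R L + 1)|%:Z.
Proof.
have phi_indep : lin_indep (@phi_tuple R G Omega F I comp phi N l).
  apply: (htensor (fun i => (twice (comp (l i))).+1) (fun i m => phi (l i) m)).
    move=> i m; exists (fun m' => (m' == m)%:R).
    rewrite (bigD1 m) //= eqxx scale1r big1 ?addr0 // => m' nm.
    by rewrite (negbTE nm) scale0r.
  move=> i; apply: (orthonormal_lin_indep hip (hH (l i))) => m m'.
  by rewrite horth eqxx.
have VL_bfun c : c \in kerMup R comp l L -> VL phi l act D (bfun phi c).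
  move=> /kerMup_string cS; rewrite bfun_expansion.
  by apply/VL_expansion => //; exact: string_intertwines.
have bfun_VL f : VL phi l act D f ->
    exists2 c, c \in kerMup R comp l L & f = bfun phi c.
  move=> fV; have [C fE] := VL_exists_expansion fV.
  move: fV; rewrite fE => /(VL_expansion heqv phi_indep)/(intertwiner_string hD).
  case=> v /string_column[c cK vE] CE; exists c => //.
  rewrite bfun_expansion -vE; congr expansion.
  by apply/funext => K; apply/funext => m; exact: CE.
have basisP (c : (\dim (kerMup R comp l L)).-tuple _) : basis_of (kerMup R comp l L) c ->
    is_basis (VL phi l act D (L := L)) (fun i => bfun phi (tnth c i)).
  move=> cB; split=> [i|a a0|f /bfun_VL[u uK ->]].
  - by apply: VL_bfun; apply: (basis_mem cB); exact: mem_tnth.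
  - have /freeP fr := basis_free cB; apply: fr.
    under eq_bigr do rewrite -tnth_nth.
    by apply: (bfun_eq0 phi_indep); rewrite bfun_sum.
  exists (fun i => coord c i u); rewrite {1}(coord_basis cB uK) bfun_sum.
  by apply: eq_bigr => i _; rewrite -tnth_nth.
split=> //; split.
  exists (fun i => bfun phi (tnth (vbasis (kerMup R comp l L)) i)).
  exact/basisP/vbasisP.
have := dim_kerMup R comp l L; have := card_blocks R comp l L.
set a := #|_|; set b := #|_|; set x := #|_|; set y := #|_|.
by lia.
Qed.
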